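(* Suppose there is an algorithm that obtains the solved forms of given word equations. Then there is an algorithm which decides satisfiability of quantifier-free formulas over word equations, length constraints and regular-expression membership, for those formulas whose word equations have solved forms that contain no unfixed parts and are regular expressions.
   Context: Fix a finite alphabet $\Sigma$. String variables range over $\Sigma^*$ and integer variables range over $\mathbb{N}$. The atomic formulas are of three kinds: - Word equations $t_1=t_2$, where $t_1,t_2$ are concatenations of string variables and constants from $\Sigma^*$. - Length constraints $\ell\le c$, where $c$ is a nonnegative integer constant and $\ell$ is a nonnegative-integer linear combination of integer variables, integer constants and terms $\mathrm{len}(t)$ for string terms $t$. - Memberships $t\in RE$, where $t$ is a string term and $RE$ is a variable-free regular expression over $\Sigma$ built with concatenation, alternation and Kleene star. The formulas in question are Boolean combinations of such atomic formulas. Unfixed parts are fresh symbols standing for arbitrary words. Integer parameters $i$ range over $\mathbb{N}$, and $u^i$ is the $i$-fold concatenation of $u$. A solved form of a word equation $w$ is a finite set of equations that is logically equivalent to $w$ and satisfies two conditions: - Each equation has the form $X=t$, where $X$ is a variable of $w$, and $t$ is a finite concatenation of constants of $w$ (possibly raised to linear integer parameters $ci$) and of unfixed parts. - Each variable of $w$ occurs exactly once as a left-hand side and never on a right-hand side. *)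

(* Defs.v *)
From Stdlib Require List.
From mathcomp Require Import all_boot all_order all_algebra.

Set Implicit Arguments.
Unset Strict Implicit.
Unset Printing Implicit Defensive.

(* Words over Sigma are [seq Sigma].  String variables and integer variables
   are two disjoint families, each indexed by nat. *)

Inductive sitem (Sigma : Type) : Type :=
  | SVar of nat
  | SConst of seq Sigma.

(* A string term is the concatenation of its items. *)
Definition sterm (Sigma : Type) := seq (sitem Sigma).

Definition weq (Sigma : Type) := (sterm Sigma * sterm Sigma)%type.

Inductive latom (Sigma : Type) : Type :=
  | LVar of nat
  | LConst of int
  | LLen of sterm Sigma.

(* The list [:: (a1, e1); ...; (an, en)] is a1 * e1 + ... + an * en. *)
Definition lexp (Sigma : Type) := seq (nat * latom Sigma).

Inductive regex (Sigma : Type) : Type :=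
  | RWord of seq Sigma
  | RCat of regex Sigma & regex Sigma
  | RAlt of regex Sigma & regex Sigma
  | RStar of regex Sigma.

Inductive formula (Sigma : Type) : Type :=
  | FEq of weq Sigma
  | FLe of lexp Sigma & nat
  | FIn of sterm Sigma & regex Sigma
  | FNot of formula Sigma
  | FAnd of formula Sigma & formula Sigma
  | FOr of formula Sigma & formula Sigma.

Arguments SVar {Sigma} _.
Arguments LVar {Sigma} _.
Arguments LConst {Sigma} _.

Section Semantics.
Variable Sigma : Type.

Inductive matches : regex Sigma -> seq Sigma -> Prop :=
  | MWord u : matches (RWord u) u
  | MCat r s u v : matches r u -> matches s v -> matches (RCat r s) (u ++ v)
  | MAltL r s u : matches r u -> matches (RAlt r s) u
  | MAltR r s u : matches s u -> matches (RAlt r s) u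
  | MStar0 r : matches (RStar r) [::]
  | MStarS r u v :
      matches r u -> matches (RStar r) v -> matches (RStar r) (u ++ v).

Definition sitem_val (sigma : nat -> seq Sigma) (x : sitem Sigma) :=
  match x with SVar X => sigma X | SConst u => u end.

Definition sterm_val (sigma : nat -> seq Sigma) (t : sterm Sigma) :=
  flatten (map (sitem_val sigma) t).

Definition weq_holds (sigma : nat -> seq Sigma) (w : weq Sigma) : Prop :=
  sterm_val sigma w.1 = sterm_val sigma w.2.

Definition latom_val (sigma : nat -> seq Sigma) (nu : nat -> nat)
    (e : latom Sigma) : int :=
  match e with
  | LVar x => (nu x)%:Z%R
  | LConst k => k
  | LLen t => (size (sterm_val sigma t))%:Z%R
  end.

Definition lexp_val (sigma : nat -> seq Sigma) (nu : nat -> nat)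
    (l : lexp Sigma) : int :=
  (\sum_(p <- l) p.1%:Z * latom_val sigma nu p.2)%R.

Fixpoint holds (sigma : nat -> seq Sigma) (nu : nat -> nat)
    (phi : formula Sigma) : Prop :=
  match phi with
  | FEq w => weq_holds sigma w
  | FLe l c => (lexp_val sigma nu l <= c%:Z)%R
  | FIn t r => matches r (sterm_val sigma t)
  | FNot phi1 => ~ holds sigma nu phi1
  | FAnd phi1 phi2 => holds sigma nu phi1 /\ holds sigma nu phi2
  | FOr phi1 phi2 => holds sigma nu phi1 \/ holds sigma nu phi2
  end.

Definition satisfiable (phi : formula Sigma) : Prop :=
  exists (sigma : nat -> seq Sigma) (nu : nat -> nat), holds sigma nu phi.

(* The word equations of a formula are all its atomic ones, of either
   polarity. *)
Fixpoint all_weqs (P : weq Sigma -> Prop) (phi : formula Sigma) : Prop :=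
  match phi with
  | FEq w => P w
  | FLe _ _ | FIn _ _ => True
  | FNot phi1 => all_weqs P phi1
  | FAnd phi1 phi2 | FOr phi1 phi2 => all_weqs P phi1 /\ all_weqs P phi2
  end.

End Semantics.

Inductive part (Sigma : Type) : Type :=
  | PConst of seq Sigma
  | PPow of seq Sigma & nat & nat  (* [PPow u c i] is u^(c * i), i a parameter *)
  | PUnfixed of nat.

Arguments PUnfixed {Sigma} _.

Definition rhs (Sigma : Type) := seq (part Sigma).

(* The pair (X, t) stands for X = t.  Right-hand sides have no string
   variables by construction; parameters and unfixed parts are shared between
   the equations of a solved form. *)
Definition eqsystem (Sigma : Type) := seq (nat * rhs Sigma).

Section SolvedForms.
Variable Sigma : eqType.

Definition sterm_vars (t : sterm Sigma) : seq nat :=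
  pmap (fun x => if x is SVar X then Some X else None) t.

Definition sterm_letters (t : sterm Sigma) : seq Sigma :=
  flatten (map (fun x => if x is SConst u then u else [::]) t).

Definition weq_vars (w : weq Sigma) := sterm_vars w.1 ++ sterm_vars w.2.

Definition weq_letters (w : weq Sigma) :=
  sterm_letters w.1 ++ sterm_letters w.2.

Definition part_val (iota : nat -> nat) (ups : nat -> seq Sigma)
    (p : part Sigma) : seq Sigma :=
  match p with
  | PConst u => u
  | PPow u c i => flatten (nseq (c * iota i) u)
  | PUnfixed k => ups k
  end.

Definition rhs_val (iota : nat -> nat) (ups : nat -> seq Sigma)
    (t : rhs Sigma) : seq Sigma :=
  flatten (map (part_val iota ups) t).

(* A constant of w is a word over the letters that occur in w: in the solved
   form X = (ab)^i a of abX = Xba, the word a is only a factor of ab. *)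
Definition part_over (w : weq Sigma) (p : part Sigma) : bool :=
  match p with
  | PConst u | PPow u _ _ => all (mem (weq_letters w)) u
  | PUnfixed _ => true
  end.

Definition is_unfixed (p : part Sigma) : bool :=
  if p is PUnfixed _ then true else false.

Definition solved_form (w : weq Sigma) (S : eqsystem Sigma) : Prop :=
  [/\ uniq (unzip1 S),
      unzip1 S =i weq_vars w,
      all (fun e => all (part_over w) e.2) S
    & forall sigma : nat -> seq Sigma,
        weq_holds sigma w <->
        exists (iota : nat -> nat) (ups : nat -> seq Sigma),
          forall X t, List.In (X, t) S -> sigma X = rhs_val iota ups t].

Definition no_unfixed (S : eqsystem Sigma) : bool :=
  all (fun e => ~~ has is_unfixed e.2) S.

(* A right-hand side is a regular expression if the words it takes, as its
   parameters range over nat, form the language of one; a^i b^i is not. *)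
Definition rhs_regular (t : rhs Sigma) : Prop :=
  exists r : regex Sigma, forall u : seq Sigma,
    matches r u <->
    exists (iota : nat -> nat) (ups : nat -> seq Sigma), u = rhs_val iota ups t.

Definition regular_solved_form (S : eqsystem Sigma) : Prop :=
  forall X t, List.In (X, t) S -> rhs_regular t.

Definition has_regular_solved_form (w : weq Sigma) : Prop :=
  exists S : eqsystem Sigma,
    [/\ solved_form w S, no_unfixed S & regular_solved_form S].

End SolvedForms.

(* The model of computation is the weak call-by-value lambda calculus (the
   calculus L of Forster and Smolka): closed untyped lambda terms in de Bruijn
   notation, with data represented by Scott encodings.  It is Turing-complete,
   and evaluation is deterministic. *)
Inductive lterm : Type :=
  | Var of nat
  | App of lterm & lterm
  | Lam of lterm.

Fixpoint closed_below (k : nat) (t : lterm) : bool :=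
  match t with
  | Var n => n < k
  | App t1 t2 => closed_below k t1 && closed_below k t2
  | Lam t1 => closed_below k.+1 t1
  end.

Definition closed_lterm (t : lterm) : bool := closed_below 0 t.

(* [u] is not lifted under binders: only closed terms are ever substituted
   when a closed term is evaluated. *)
Fixpoint lsubst (t : lterm) (k : nat) (u : lterm) : lterm :=
  match t with
  | Var n => if n == k then u else Var n
  | App t1 t2 => App (lsubst t1 k u) (lsubst t2 k u)
  | Lam t1 => Lam (lsubst t1 k.+1 u)
  end.

Inductive evals : lterm -> lterm -> Prop :=
  | EvalLam t : evals (Lam t) (Lam t)
  | EvalApp s t s1 v r :
      evals s (Lam s1) -> evals t v -> evals (lsubst s1 0 v) r ->
      evals (App s t) r.

(* Scott encoding of the k-th of the n constructors of a data type, applied to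
   arguments with encodings a_1, ..., a_m: the term
   fun c_0 ... c_(n-1) => c_k a_1 ... a_m. *)
Definition scott (n k : nat) (args : seq lterm) : lterm :=
  iter n Lam (foldl App (Var (n - k.+1)) args).

Definition enc_bool (b : bool) : lterm :=
  if b then scott 2 0 [::] else scott 2 1 [::].

Fixpoint enc_nat (n : nat) : lterm :=
  if n is n1.+1 then scott 2 1 [:: enc_nat n1] else scott 2 0 [::].

Definition enc_int (z : int) : lterm :=
  match z with
  | Posz n => scott 2 0 [:: enc_nat n]
  | Negz n => scott 2 1 [:: enc_nat n]
  end.

Definition enc_pair (A B : Type) (f : A -> lterm) (g : B -> lterm)
    (p : A * B) : lterm :=
  scott 1 0 [:: f p.1; g p.2].

Fixpoint enc_seq (A : Type) (f : A -> lterm) (s : seq A) : lterm :=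
  if s is x :: s1 then scott 2 1 [:: f x; enc_seq f s1] else scott 2 0 [::].

Section Encodings.
Variable Sigma : finType.

Definition enc_letter (a : Sigma) : lterm := enc_nat (enum_rank a).

Definition enc_word : seq Sigma -> lterm := enc_seq enc_letter.

Definition enc_sitem (x : sitem Sigma) : lterm :=
  match x with
  | SVar X => scott 2 0 [:: enc_nat X]
  | SConst u => scott 2 1 [:: enc_word u]
  end.

Definition enc_sterm : sterm Sigma -> lterm := enc_seq enc_sitem.

Definition enc_weq : weq Sigma -> lterm := enc_pair enc_sterm enc_sterm.

Definition enc_latom (e : latom Sigma) : lterm :=
  match e with
  | LVar x => scott 3 0 [:: enc_nat x]
  | LConst k => scott 3 1 [:: enc_int k]
  | LLen t => scott 3 2 [:: enc_sterm t]
  end.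

Definition enc_lexp : lexp Sigma -> lterm :=
  enc_seq (enc_pair enc_nat enc_latom).

Fixpoint enc_regex (r : regex Sigma) : lterm :=
  match r with
  | RWord u => scott 4 0 [:: enc_word u]
  | RCat r1 r2 => scott 4 1 [:: enc_regex r1; enc_regex r2]
  | RAlt r1 r2 => scott 4 2 [:: enc_regex r1; enc_regex r2]
  | RStar r1 => scott 4 3 [:: enc_regex r1]
  end.

Fixpoint enc_formula (phi : formula Sigma) : lterm :=
  match phi with
  | FEq w => scott 6 0 [:: enc_weq w]
  | FLe l c => scott 6 1 [:: enc_lexp l; enc_nat c]
  | FIn t r => scott 6 2 [:: enc_sterm t; enc_regex r]
  | FNot phi1 => scott 6 3 [:: enc_formula phi1]
  | FAnd phi1 phi2 => scott 6 4 [:: enc_formula phi1; enc_formula phi2]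
  | FOr phi1 phi2 => scott 6 5 [:: enc_formula phi1; enc_formula phi2]
  end.

Definition enc_part (p : part Sigma) : lterm :=
  match p with
  | PConst u => scott 3 0 [:: enc_word u]
  | PPow u c i => scott 3 1 [:: enc_word u; enc_nat c; enc_nat i]
  | PUnfixed k => scott 3 2 [:: enc_nat k]
  end.

Definition enc_eqsystem : eqsystem Sigma -> lterm :=
  enc_seq (enc_pair enc_nat (enc_seq enc_part)).

(* Nothing is required on equations that have no solved form: the algorithm
   need not even halt on them. *)
Definition obtains_solved_forms (A : lterm) : Prop :=
  forall w : weq Sigma, (exists S : eqsystem Sigma, solved_form w S) ->
  exists2 S : eqsystem Sigma,
    solved_form w S & evals (App A (enc_weq w)) (enc_eqsystem S).

Definition decides_satisfiability_on (P : formula Sigma -> Prop) (B : lterm) :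
    Prop :=
  forall phi : formula Sigma, P phi ->
  exists2 b : bool,
    evals (App B (enc_formula phi)) (enc_bool b) & b <-> satisfiable phi.

End Encodings.

(* Main.v *)
Require Import Defs.
From mathcomp Require Import all_boot all_order all_algebra.
From mathcomp Require Import zify.
From HB Require Import structures.
From Stdlib Require Import Setoid Morphisms ClassicalEpsilon.

Set Implicit Arguments.
Unset Strict Implicit.
Unset Printing Implicit Defensive.

(** Let [vs] list, in order, the words that occur in the solved forms computed
    for the equations of the formula, followed by the letters.  A solution of an
    equation takes its values in [v1^* v2^* ... vN^*]: an unfixed part over at
    least two letters would take a value [(a^p b)^m] that is no factor of a
    value of the solved form without unfixed parts.

    Fix a satisfying assignment.  A value outside [v1^* ... vN^*] falsifies every
    equation that contains its variable, and can be replaced by a short word that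
    acts in the same way on the automata of the regular expressions, one of which
    recognizes [v1^* ... vN^*].  The other values are given by vectors of
    exponents.  The truth of an equation then depends only on the residues of the
    exponents modulo [n!] and on bounded linear comparisons between them, because
    a mismatch between two products of powers can be moved close to the beginning
    of the overlap of two blocks.  A pigeonhole argument on the binary digits of
    the exponents yields small exponents with the same residues and comparisons.
    So a satisfiable formula has a model of computably bounded size, and the
    algorithm searches for it. *)

(** * Equational reasoning about evaluation *)

(** The solved forms are not substituted into the formula: equations may be negated and share
    variables, so substitution would leave equations and disequations between products of powers,
    under length and membership constraints. The solved forms only supply the words [vs]; the rest
    is one relation between assignments that preserves equations, memberships and length constraints
    at once. The solved form returned by the given algorithm need not be the one assumed to exist.
    Both have the same solutions, and the absence of unfixed parts has to be carried over from one
    to the other. Over one letter this fails, since an unfixed part then takes the same values as a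
    power with a parameter; the letters in [vs] cover this case. The programs are built from one
    recursor for Scott encodings. Choice only names the outputs of the given algorithm, as a
    function on the equations on which it is known to halt. *)

Definition eqv (s t : lterm) : Prop := forall r, evals s r <-> evals t r.

#[global] Instance eqv_equivalence : Equivalence eqv.
Proof.
split=> [s r|s t st r|s t u st tu r] //; first by split=> /st.
by split=> [/st/tu|/tu/st].
Qed.

(** Evaluation is weak: application is a congruence and abstraction is not, so rewriting takes place
    outside binders only. *)
#[global] Instance App_eqv_morphism : Proper (eqv ==> eqv ==> eqv) App.
Proof.
suff imp s s' t t' r : eqv s s' -> eqv t t' ->
    evals (App s t) r -> evals (App s' t') r.
  by move=> s s' ss' t t' tt' r; split; apply: imp => //; symmetry.
move=> ss' tt' e; inversion e as [|? ? s1 v ? es et er]; subst.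
by apply: EvalApp er; [apply/ss'|apply/tt'].
Qed.

Lemma evals_value s v : evals s v -> exists t, v = Lam t.
Proof. by elim=> [t|]; [exists t|]. Qed.

Lemma evals_det s v1 v2 : evals s v1 -> evals s v2 -> v1 = v2.
Proof.
move=> e1; elim: e1 v2 => [t|s1 t1 s2 v r e1 IH1 e2 IH2 e3 IH3] v2 e.
  by inversion e.
inversion e as [|? ? s2' v' ? es et er]; subst; apply: IH3.
by have [->] := IH1 _ es; rewrite (IH2 _ et).
Qed.

Lemma evals_eqv s v : evals s v -> eqv s v.
Proof.
move=> e r; split=> [e'|].
  by rewrite (evals_det e' e); have [t ->] := evals_value e; exact: EvalLam.
have [t vE] := evals_value e; rewrite vE => e'; inversion e'; subst.
exact: e.
Qed.

Lemma closed_below_leq t k l : k <= l -> closed_below k t -> closed_below l t.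
Proof.
elim: t k l => [n|t1 IH1 t2 IH2|t IH] k l kl /=.
- by move=> nk; exact: leq_trans kl.
- by case/andP=> /(IH1 _ _ kl)-> /(IH2 _ _ kl)->.
- exact: IH.
Qed.

Lemma lsubst_closed t k u l : closed_below k t -> k <= l -> lsubst t l u = t.
Proof.
elim: t k l => [n|t1 IH1 t2 IH2|t IH] k l //= c kl.
- by rewrite ltn_eqF// (leq_trans c kl).
- by case/andP: c => c1 c2; rewrite (IH1 k)// (IH2 k).
- by rewrite (IH k.+1).
Qed.

(* Locked, because [simpl] would unfold [lsubst] on open terms. *)
HB.lock Definition sub t k u := lsubst t k u.

Lemma sub_app s t k u : sub (App s t) k u = App (sub s k u) (sub t k u).
Proof. by rewrite unlock. Qed.

Lemma sub_lam s k u : sub (Lam s) k u = Lam (sub s k.+1 u).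
Proof. by rewrite unlock. Qed.

Lemma sub_var_eq k u : sub (Var k) k u = u.
Proof. by rewrite unlock /= eqxx. Qed.

Lemma sub_var_neq n k u : n != k -> sub (Var n) k u = Var n.
Proof. by rewrite unlock /= => /negbTE->. Qed.

Definition is_lam (t : lterm) : bool := if t is Lam _ then true else false.

(* Closed abstractions: [beta] and [sub_ct] hold for them without side conditions. *)
Record cterm := CTerm { ct :> lterm; ctP : closed_lterm ct && is_lam ct }.

Lemma closed_ct k (t : cterm) : closed_below k t.
Proof. by case: t => t /= /andP[c _]; apply: closed_below_leq c. Qed.

Lemma sub_ct k (t : cterm) u : sub t k u = t.
Proof. rewrite unlock; exact: lsubst_closed (closed_ct 0 t) _. Qed.

Lemma evals_ct (t : cterm) : evals t t.
Proof. by case: t => -[n|s t|t] //= H; [case/andP: H..|exact: EvalLam]. Qed.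

Lemma eqv_evals s (v : cterm) : eqv s v -> evals s v.
Proof. by move=> sv; apply/sv; exact: evals_ct. Qed.

Lemma beta s (v : cterm) : eqv (App (Lam s) v) (sub s 0 v).
Proof.
rewrite unlock.
move=> r; split=> [e|e].
  inversion e as [|? ? s1 v1 ? es et er]; subst.
  by inversion es; subst; rewrite (evals_det (evals_ct v) et).
by apply: EvalApp e; [exact: EvalLam|exact: evals_ct].
Qed.

Ltac lclosed := by rewrite /closed_lterm /= ?closed_ct.
Ltac lred :=
  repeat first [ rewrite sub_ct | rewrite sub_app | rewrite sub_lam
               | rewrite sub_var_eq | rewrite sub_var_neq; last by [] | rewrite beta ].

Notation apps := (foldl App).

Lemma apps_eqv h h' ts : eqv h h' -> eqv (apps h ts) (apps h' ts).
Proof. by elim: ts h h' => //= t ts IH h h' hh'; apply: IH; rewrite hh'. Qed.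

Lemma sub_apps h (ts : seq cterm) k u :
  sub (apps h (map ct ts)) k u = apps (sub h k u) (map ct ts).
Proof. by elim: ts h => //= t ts IH h; rewrite IH sub_app sub_ct. Qed.

Lemma sub_lams n t k u :
  sub (iter n Lam t) k u = iter n Lam (sub t (n + k) u).
Proof. by elim: n k => //= n IH k; rewrite ?sub_lam IH addnS. Qed.

Lemma apps_lams_const (h : cterm) (args bs : seq cterm) :
  eqv (apps (iter (size bs) Lam (apps h (map ct args))) (map ct bs))
      (apps h (map ct args)).
Proof.
elim: bs => //= b bs IH; rewrite -[X in eqv _ X]IH; apply: apps_eqv.
by rewrite beta sub_lams sub_apps sub_ct.
Qed.

(** The index [j] under [size bs] binders denotes the binder number [size bs - j.+1] from the
    outside. Arguments before it are discarded one by one; [apps_lams_const] discards those after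
    it. *)
Lemma apps_lams_var j (args bs : seq cterm) (d : cterm) : j < size bs ->
  eqv (apps (iter (size bs) Lam (apps (Var j) (map ct args))) (map ct bs))
      (apps (nth d bs (size bs - j.+1)) (map ct args)).
Proof.
elim: bs => //= b bs IH; rewrite ltnS leq_eqVlt => jbs.
have step h : sub (Var j) (size bs) b = h ->
    eqv (App (Lam (iter (size bs) Lam (apps (Var j) (map ct args)))) b)
        (iter (size bs) Lam (apps h (map ct args))).
  by move=> <-; rewrite beta sub_lams sub_apps addn0.
have [je|jne] := eqVneq j (size bs).
  rewrite /= (apps_eqv _ (step b _)); last by rewrite je sub_var_eq.
  by rewrite je subnn; exact: apps_lams_const.
move: jbs; rewrite (negbTE jne) /= => jbs.
rewrite (apps_eqv _ (step (Var j) _)); last by rewrite sub_var_neq.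
by rewrite (IH jbs) subSS -[in X in nth d (b :: bs) X](subnSK jbs).
Qed.

Lemma apps_scott n k (args bs : seq cterm) (d : cterm) : size bs = n -> k < n ->
  eqv (apps (scott n k (map ct args)) (map ct bs))
      (apps (nth d bs k) (map ct args)).
Proof.
move=> <- kn; rewrite /scott (apps_lams_var _ d) ?subnSK ?leq_subr//.
by rewrite subKn// ltnW.
Qed.

(** * Computable functions *)

Class enc_type (A : Type) := enc : A -> cterm.

(** Stated with [eqv] rather than [evals], so that realizers compose by rewriting. *)
Definition computable A B `{enc_type A} `{enc_type B} (f : A -> B) : Prop :=
  exists t : cterm, forall a, eqv (App t (enc a)) (enc (f a)).

Lemma closed_lams n t k : closed_below k (iter n Lam t) = closed_below (n + k) t.
Proof. by elim: n k => //= n IH k; rewrite ?sub_lam IH addnS. Qed.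

Lemma ctP_scott n k args : all closed_lterm args -> k < n ->
  closed_lterm (scott n k args) && is_lam (scott n k args).
Proof.
move=> cargs kn; case: n kn => // n kn; rewrite andbT /closed_lterm /scott.
rewrite closed_lams addn0.
have: closed_below n.+1 (Var (n.+1 - k.+1)) by rewrite /= subSS ltnS leq_subr.
elim: args cargs (Var _) => //= a args IH /andP[ca cargs] h ch; apply: IH => //=.
by rewrite ch (closed_below_leq _ ca).
Qed.

Lemma ct_closed (t : cterm) : closed_lterm t.
Proof. exact: closed_ct. Qed.

Lemma closed_and_lam t : closed_lterm t && is_lam t -> closed_lterm t.
Proof. by case/andP. Qed.

Lemma ctP_bool b : closed_lterm (enc_bool b) && is_lam (enc_bool b).
Proof. by case: b. Qed.

Lemma ctP_nat n : closed_lterm (enc_nat n) && is_lam (enc_nat n).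
Proof. by elim: n => //= n /closed_and_lam c; rewrite ctP_scott //= c. Qed.

#[global] Instance enc_type_bool : enc_type bool := fun b => CTerm (ctP_bool b).
#[global] Instance enc_type_nat : enc_type nat := fun n => CTerm (ctP_nat n).

Section EncodedTypes.
Context (A B : Type) {eA : enc_type A} {eB : enc_type B}.

Lemma ctP_pair (p : A * B) :
  let t := enc_pair (fun a => enc a) (fun b => enc b) p in
  closed_lterm t && is_lam t.
Proof. by rewrite /= ctP_scott //= !ct_closed. Qed.

Lemma ctP_seq (s : seq A) :
  let t := enc_seq (fun a => enc a) s in closed_lterm t && is_lam t.
Proof. by elim: s => //= a s /closed_and_lam c; rewrite ctP_scott //= ct_closed c. Qed.

#[global] Instance enc_type_pair : enc_type (A * B) := fun p => CTerm (ctP_pair p).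
#[global] Instance enc_type_seq : enc_type (seq A) := fun s => CTerm (ctP_seq s).
(* A function defined only on the inputs that satisfy [P] is a total function on
   [{a | P a}]. *)
#[global] Instance enc_type_sig (P : A -> Prop) : enc_type {a | P a} :=
  fun x => enc (proj1_sig x).
End EncodedTypes.

Lemma ctP_int z : closed_lterm (enc_int z) && is_lam (enc_int z).
Proof.
by case: z => n /=; rewrite ctP_scott //= andbT (closed_and_lam (ctP_nat n)).
Qed.
#[global] Instance enc_type_int : enc_type int := fun z => CTerm (ctP_int z).

Definition cpair : cterm :=
  @CTerm (Lam (Lam (Lam (App (App (Var 0) (Var 2)) (Var 1))))) isT.
Definition ctrue2 : cterm := @CTerm (Lam (Lam (Var 1))) isT.
Definition cfalse2 : cterm := @CTerm (Lam (Lam (Var 0))) isT.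
Definition cid : cterm := @CTerm (Lam (Var 0)) isT.

Definition ccomp (t u : cterm) : cterm.
Proof. by refine (@CTerm (Lam (App t (App u (Var 0)))) _); lclosed. Defined.
Definition cjoin (t u : cterm) : cterm.
Proof.
refine (@CTerm (Lam (App (App cpair (App t (Var 0))) (App u (Var 0)))) _).
by lclosed.
Defined.
Definition cconst (v : cterm) : cterm.
Proof. by refine (@CTerm (Lam v) _); lclosed. Defined.
Definition cproj (v : cterm) : cterm.
Proof. by refine (@CTerm (Lam (App (Var 0) v)) _); lclosed. Defined.

Lemma cpairE A B `{enc_type A} `{enc_type B} (a : A) (b : B) :
  eqv (App (App cpair (enc a)) (enc b)) (enc (a, b)).
Proof. by lred. Qed.

Lemma comp_ext A B `{enc_type A} `{enc_type B} (f g : A -> B) :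
  (forall a, enc (f a) = enc (g a)) -> computable f -> computable g.
Proof. by move=> fg [t tP]; exists t => a; rewrite -fg. Qed.

Lemma comp_id A `{enc_type A} : computable (fun a : A => a).
Proof. by exists cid => a; lred. Qed.

Lemma comp_const A B `{enc_type A} `{enc_type B} (b : B) : computable (fun _ : A => b).
Proof. by exists (cconst (enc b)) => a; lred. Qed.

Lemma comp_comp A B C `{enc_type A} `{enc_type B} `{enc_type C}
  (g : B -> C) (f : A -> B) :
  computable g -> computable f -> computable (fun a => g (f a)).
Proof. by move=> [t tP] [u uP]; exists (ccomp t u) => a; lred; rewrite uP tP. Qed.

Lemma comp_pair A B C `{enc_type A} `{enc_type B} `{enc_type C}
  (f : C -> A) (g : C -> B) :
  computable f -> computable g -> computable (fun c => (f c, g c)).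
Proof.
move=> [t tP] [u uP]; exists (cjoin t u) => c.
by lred; rewrite tP uP; exact: cpairE.
Qed.

Lemma cprojE (v x : cterm) : eqv (App (cproj v) x) (App x v).
Proof. by lred. Qed.

Lemma cproj_fst A B `{enc_type A} `{enc_type B} (p : A * B) :
  eqv (App (cproj ctrue2) (enc p)) (enc p.1).
Proof.
case: p => a b; rewrite cprojE; etransitivity.
  exact: (@apps_scott 1 0 [:: enc a; enc b] [:: ctrue2] ctrue2 erefl isT).
by rewrite [apps _ _]/=; lred.
Qed.

Lemma cproj_snd A B `{enc_type A} `{enc_type B} (p : A * B) :
  eqv (App (cproj cfalse2) (enc p)) (enc p.2).
Proof.
case: p => a b; rewrite cprojE; etransitivity.
  exact: (@apps_scott 1 0 [:: enc a; enc b] [:: cfalse2] cfalse2 erefl isT).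
by rewrite [apps _ _]/=; lred.
Qed.

Lemma comp_proj1 A B `{enc_type A} `{enc_type B} : computable (@fst A B).
Proof. by exists (cproj ctrue2) => p; exact: cproj_fst. Qed.

Lemma comp_proj2 A B `{enc_type A} `{enc_type B} : computable (@snd A B).
Proof. by exists (cproj cfalse2) => p; exact: cproj_snd. Qed.

Lemma comp_fst A B C `{enc_type A} `{enc_type B} `{enc_type C} (f : C -> A * B) :
  computable f -> computable (fun c => (f c).1).
Proof. exact: comp_comp comp_proj1. Qed.

Lemma comp_snd A B C `{enc_type A} `{enc_type B} `{enc_type C} (f : C -> A * B) :
  computable f -> computable (fun c => (f c).2).
Proof. exact: comp_comp comp_proj2. Qed.

(** * Recursion on encoded data *)

Lemma closed_apps k h (ts : seq cterm) :
  closed_below k (apps h (map ct ts)) = closed_below k h.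
Proof. by elim: ts h => //= t ts IH h; rewrite IH /= closed_ct andbT. Qed.

(* The recursor carries itself as its first argument, so that the branch of a
   constructor can apply it to the recursive arguments. *)
Definition crec (bs : seq cterm) : cterm.
Proof.
refine (@CTerm (Lam (Lam (Lam
  (App (App (apps (Var 1) (map ct bs)) (Var 2)) (Var 0))))) _).
by rewrite /closed_lterm /= closed_apps.
Defined.

Definition ctuple := foldl (fun p q => App (App cpair p) q).

(* The constructor has [size recs] arguments; [recs] marks the recursive ones. *)
Definition branch_body (t : cterm) (recs : seq bool) : lterm :=
  let arg i := Var (size recs - i).+1 in
  App t (ctuple (Var 0)
    (map arg (iota 0 (size recs)) ++
     map (fun i => App (App (App (Var 1) (Var 1)) (arg i)) (Var 0))
       (filter (nth false recs) (iota 0 (size recs))))).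

Lemma closed_branch (t : cterm) recs :
  let b := iter (size recs).+2 Lam (branch_body t recs) in closed_lterm b && is_lam b.
Proof.
apply/andP; split=> //; rewrite /closed_lterm closed_lams addn0.
rewrite /branch_body /= closed_ct /=.
have arg i : closed_below (size recs).+2 (Var (size recs - i).+1).
  by rewrite /= !ltnS leq_subr.
have tuple_closed k p ts : closed_below k p -> all (closed_below k) ts ->
    closed_below k (ctuple p ts).
  by elim: ts p => //= q ts IH p cp /andP[cq cts]; apply: IH; rewrite //= cp.
apply: tuple_closed => //; rewrite all_cat !all_map.
apply/andP; split; apply/allP => i _; first exact: arg.
by rewrite /= !ltnS leq_subr.
Qed.

Definition branch t recs : cterm := CTerm (closed_branch t recs).

Opaque cpair.

Lemma crec_apps (bs : seq cterm) (D x c : cterm) :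
  eqv (App (App (App (crec bs) D) x) c)
      (App (App (apps x (map ct bs)) D) c).
Proof.
rewrite -[ct (crec bs)]/(Lam (Lam (Lam
  (App (App (apps (Var 1) (map ct bs)) (Var 2)) (Var 0))))).
by do 3 (lred; rewrite ?sub_apps).
Qed.

Lemma crecE (bs : seq cterm) n k (args : seq cterm) (x c : cterm) :
  ct x = scott n k (map ct args) -> size bs = n -> k < n ->
  eqv (App (App (App (crec bs) (crec bs)) x) c)
      (App (App (apps (nth cid bs k) (map ct args)) (crec bs)) c).
Proof.
move=> xE sbs kn; rewrite crec_apps xE (apps_scott args cid sbs kn); reflexivity.
Qed.

Ltac lred_branch :=
  rewrite /branch [ct (CTerm _)]/= /branch_body /=;
  repeat first [ rewrite cpairE | rewrite sub_ct | rewrite sub_app | rewrite sub_lam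
               | rewrite sub_var_eq | rewrite sub_var_neq; last by []
               | match goal with |- context [App (Lam ?s) (ct ?v)] =>
                   rewrite (beta s v) end ].

Section Branches.
Context (C R : Type) {eC : enc_type C} {eR : enc_type R} (t D : cterm) (c : C).
Local Notation rec_val a r :=
  (eqv (App (App (App D D) (enc a)) (enc c)) (enc r)).

(** The suffixes below spell the list [recs], with [t] for a recursive argument. A branch passes to
    its realizer the left-nested tuple of the context, the arguments and the results of the
    recursive calls. *)
Lemma branch0 :
  eqv (App (App (branch t [::]) D) (enc c)) (App t (enc c)).
Proof. by lred_branch. Qed.

Lemma branch_f A (eA : enc_type A) (a : A) :
  eqv (App (App (App (branch t [:: false]) (enc a)) D) (enc c))
      (App t (enc (c, a))).
Proof. by lred_branch. Qed.

Lemma branch_ff A B (eA : enc_type A) (eB : enc_type B) (a : A) (b : B) :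
  eqv (App (App (App (App (branch t [:: false; false]) (enc a)) (enc b)) D) (enc c))
      (App t (enc (c, a, b))).
Proof. by lred_branch. Qed.

Lemma branch_fff A A' B (eA : enc_type A) (eA' : enc_type A') (eB : enc_type B)
    (a : A) (a' : A') (b : B) :
  eqv (App (App (App (App (App (branch t [:: false; false; false])
        (enc a)) (enc a')) (enc b)) D) (enc c))
      (App t (enc (c, a, a', b))).
Proof. by lred_branch. Qed.

Lemma branch_t A (eA : enc_type A) (a : A) (r : R) : rec_val a r ->
  eqv (App (App (App (branch t [:: true]) (enc a)) D) (enc c))
      (App t (enc (c, a, r))).
Proof.
by move=> ar; lred_branch; rewrite ar !cpairE.
Qed.

Lemma branch_ft A B (eA : enc_type A) (eB : enc_type B) (a : A) (b : B) (r : R) :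
  rec_val b r ->
  eqv (App (App (App (App (branch t [:: false; true]) (enc a)) (enc b)) D) (enc c))
      (App t (enc (c, a, b, r))).
Proof.
by move=> ar; lred_branch; rewrite ar !cpairE.
Qed.

Lemma branch_tt A B (eA : enc_type A) (eB : enc_type B) (a : A) (b : B) (r s : R) :
  rec_val a r -> rec_val b s ->
  eqv (App (App (App (App (branch t [:: true; true]) (enc a)) (enc b)) D) (enc c))
      (App t (enc (c, a, b, r, s))).
Proof.
by move=> ar bs; lred_branch; rewrite ar bs !cpairE.
Qed.
End Branches.

(** The recursor expects the datum before the context, whereas functions with a parameter are
    computed on pairs with the context first. *)
Definition crun (D : cterm) : cterm.
Proof.
refine (@CTerm (Lam (App (App (App D D) (App (cproj cfalse2) (Var 0)))
                         (App (cproj ctrue2) (Var 0)))) _).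
by lclosed.
Defined.

Lemma crunE (D x : cterm) :
  eqv (App (crun D) x)
      (App (App (App D D) (App (cproj cfalse2) x)) (App (cproj ctrue2) x)).
Proof. by rewrite beta !sub_app !sub_ct sub_var_eq. Qed.

Lemma comp_crec A C R `{enc_type A} `{enc_type C} `{enc_type R}
    (F : C -> A -> R) (bs : seq cterm) :
  (forall c a, eqv (App (App (App (crec bs) (crec bs)) (enc a)) (enc c)) (enc (F c a))) ->
  computable (fun p : C * A => F p.1 p.2).
Proof. by move=> FP; exists (crun (crec bs)) => p; rewrite crunE cproj_fst cproj_snd. Qed.

Section DataRecursion.
Context (C R : Type) {eC : enc_type C} {eR : enc_type R}.

Lemma comp_nat_rec (F : C -> nat -> R) f0 f1 :
  computable f0 -> computable (fun p : C * nat * R => f1 p.1.1 p.1.2 p.2) ->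
  (forall c, F c 0 = f0 c) -> (forall c n, F c n.+1 = f1 c n (F c n)) ->
  computable (fun p : C * nat => F p.1 p.2).
Proof.
move=> [t0 t0P] [t1 t1P] F0 F1.
apply: (comp_crec (bs := [:: branch t0 [::]; branch t1 [:: true]])) => // c.
elim=> [|n IH].
  by rewrite (@crecE _ 2 0 [::])// [nth _ _ _]/= branch0 F0 -t0P.
by rewrite (@crecE _ 2 1 [:: enc n])// F1 -(t1P (c, n, F c n)); exact: branch_t.
Qed.

Lemma comp_seq_rec A (eA : enc_type A) (F : C -> seq A -> R) f0 f1 :
  computable f0 -> computable (fun p : C * A * seq A * R => f1 p.1.1.1 p.1.1.2 p.1.2 p.2) ->
  (forall c, F c [::] = f0 c) -> (forall c a s, F c (a :: s) = f1 c a s (F c s)) ->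
  computable (fun p : C * seq A => F p.1 p.2).
Proof.
move=> [t0 t0P] [t1 t1P] F0 F1.
apply: (comp_crec (bs := [:: branch t0 [::]; branch t1 [:: false; true]])) => // c.
elim=> [|a s IH].
  by rewrite (@crecE _ 2 0 [::])// [nth _ _ _]/= branch0 F0 -t0P.
rewrite (@crecE _ 2 1 [:: enc a; enc s])// F1 -(t1P (c, a, s, F c s)).
exact: branch_ft.
Qed.

Lemma comp_int_case (F : C -> int -> R) f0 f1 :
  computable (fun p : C * nat => f0 p.1 p.2) ->
  computable (fun p : C * nat => f1 p.1 p.2) ->
  (forall c n, F c (Posz n) = f0 c n) -> (forall c n, F c (Negz n) = f1 c n) ->
  computable (fun p : C * int => F p.1 p.2).
Proof.
move=> [t0 t0P] [t1 t1P] F0 F1.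
apply: (comp_crec (bs := [:: branch t0 [:: false]; branch t1 [:: false]])) => // c.
case=> n.
  by rewrite (@crecE _ 2 0 [:: enc n])// F0 -(t0P (c, n)); exact: branch_f.
by rewrite (@crecE _ 2 1 [:: enc n])// F1 -(t1P (c, n)); exact: branch_f.
Qed.

Lemma comp_bool_case (F : C -> bool -> R) f0 f1 : computable f0 -> computable f1 ->
  (forall c, F c true = f0 c) -> (forall c, F c false = f1 c) ->
  computable (fun p : C * bool => F p.1 p.2).
Proof.
move=> [t0 t0P] [t1 t1P] F0 F1.
apply: (comp_crec (bs := [:: branch t0 [::]; branch t1 [::]])) => // c.
case.
  by rewrite (@crecE _ 2 0 [::])// F0 -t0P; exact: branch0.
by rewrite (@crecE _ 2 1 [::])// F1 -t1P; exact: branch0.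
Qed.
End DataRecursion.

(** * A library of computable functions *)

Definition csucc : cterm := @CTerm (Lam (Lam (Lam (App (Var 0) (Var 2))))) isT.
Definition ccons : cterm :=
  @CTerm (Lam (Lam (Lam (Lam (App (App (Var 0) (Var 3)) (Var 2)))))) isT.

(** In goals of the form [computable (fun c => _)] the variable [c] is an environment. This lemma
    isolates one argument, on which a recursion scheme can then act. *)
Lemma comp_at C (eC : enc_type C) A R (eA : enc_type A) (eR : enc_type R) (F : C -> A -> R) a :
  computable (fun p : C * A => F p.1 p.2) ->
  computable a -> computable (fun c => F c (a c)).
Proof.
move=> cF ca; apply: (comp_comp (g := fun p => F p.1 p.2) (f := fun c => (c, a c)) cF).
by apply: comp_pair => //; exact: comp_id.
Qed.

Lemma comp_succ C (eC : enc_type C) (n : C -> nat) :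
  computable n -> computable (fun c => (n c).+1).
Proof. by apply: (comp_comp (g := S)); exists csucc => n'; lred. Qed.

Lemma cconsE A (eA : enc_type A) (a : A) (s : seq A) :
  eqv (App (App ccons (enc a)) (enc s)) (enc (a :: s)).
Proof. by lred. Qed.

Lemma comp_cons C (eC : enc_type C) A (eA : enc_type A) (a : C -> A) s :
  computable a -> computable s -> computable (fun c => a c :: s c).
Proof.
move=> [t tP] [u uP].
have cl : let v := Lam (App (App ccons (App t (Var 0))) (App u (Var 0))) in
    closed_lterm v && is_lam v by lclosed.
exists (CTerm cl) => c; rewrite -cconsE -tP -uP.
by rewrite beta !sub_app !sub_ct sub_var_eq.
Qed.

Lemma comp_if C (eC : enc_type C) R (eR : enc_type R) (b : C -> bool) (x y : C -> R) :
  computable b -> computable x -> computable y -> computable (fun c => if b c then x c else y c).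
Proof.
move=> cb cx cy; apply: (comp_at (F := fun c b => if b then x c else y c)) => //.
by apply: (comp_bool_case (F := fun c (b : bool) => if b then x c else y c) cx cy).
Qed.
Ltac comp_step :=
  first
  [ assumption | simple apply comp_const
  | lazymatch goal with
    | |- computable (fun c => c) => simple apply comp_id
    | |- computable fst => simple apply comp_proj1
    | |- computable snd => simple apply comp_proj2
    | |- computable (fun c => fst _) => refine (comp_fst _)
    | |- computable (fun c => snd _) => refine (comp_snd _)
    | |- computable (fun c => (_, _)) => simple apply comp_pair
    | |- computable (fun c => S _) => simple apply comp_succ
    | |- computable (fun c => _ :: _) => simple apply comp_cons
    | |- computable (fun c => if _ then _ else _) => simple apply comp_if
    end ].

Lemma comp_seqrec_at C (eC : enc_type C) A R (eA : enc_type A) (eR : enc_type R)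
    (F : C -> seq A -> R) f0 f1 s :
  computable f0 -> computable (fun p : C * A * seq A * R => f1 p.1.1.1 p.1.1.2 p.1.2 p.2) ->
  (forall c, F c [::] = f0 c) -> (forall c a s, F c (a :: s) = f1 c a s (F c s)) ->
  computable s -> computable (fun c => F c (s c)).
Proof. by move=> c0 c1 F0 F1; apply: comp_at; exact: comp_seq_rec c0 c1 F0 F1. Qed.

Lemma comp_natrec_at C (eC : enc_type C) R (eR : enc_type R) (F : C -> nat -> R) f0 f1 n :
  computable f0 -> computable (fun p : C * nat * R => f1 p.1.1 p.1.2 p.2) ->
  (forall c, F c 0 = f0 c) -> (forall c n, F c n.+1 = f1 c n (F c n)) ->
  computable n -> computable (fun c => F c (n c)).
Proof. by move=> c0 c1 F0 F1; apply: comp_at; exact: comp_nat_rec c0 c1 F0 F1. Qed.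

Lemma comp_negb C (eC : enc_type C) (b : C -> bool) :
  computable b -> computable (fun c => ~~ b c).
Proof.
move=> cb; apply: (comp_ext (f := fun c => if b c then false else true)).
  by move=> c; case: (b c).
by repeat comp_step.
Qed.

Lemma comp_andb C (eC : enc_type C) (a b : C -> bool) :
  computable a -> computable b -> computable (fun c => a c && b c).
Proof.
by move=> ca cb; apply: (comp_ext (f := fun c => if a c then b c else false));
   repeat comp_step.
Qed.

Lemma comp_orb C (eC : enc_type C) (a b : C -> bool) :
  computable a -> computable b -> computable (fun c => a c || b c).
Proof.
by move=> ca cb; apply: (comp_ext (f := fun c => if a c then true else b c));
   repeat comp_step.
Qed.

Lemma comp_iter C (eC : enc_type C) R (eR : enc_type R) (f : C -> R -> R) n x :
  computable (fun p : C * R => f p.1 p.2) -> computable n -> computable x ->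
  computable (fun c => iter (n c) (f c) (x c)).
Proof.
move=> cf cn cx.
apply: (comp_natrec_at (F := fun c n => iter n (f c) (x c)) (f0 := x)
  (f1 := fun c _ r => f c r)) => //.
apply: (comp_comp (g := fun p => f p.1 p.2)
  (f := fun p : C * nat * R => (p.1.1, p.2))) => //.
by repeat comp_step.
Qed.

Lemma comp_pred C (eC : enc_type C) (n : C -> nat) :
  computable n -> computable (fun c => (n c).-1).
Proof.
move=> cn; apply: (comp_natrec_at (F := fun c n => n.-1) (f0 := fun _ => 0)
  (f1 := fun c n _ => n)) => //; by repeat comp_step.
Qed.

Lemma comp_map C (eC : enc_type C) A B (eA : enc_type A) (eB : enc_type B) (f : C -> A -> B) s :
  computable (fun p : C * A => f p.1 p.2) -> computable s ->
  computable (fun c => [seq f c a | a <- s c]).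
Proof.
move=> cf; apply: (comp_seqrec_at (F := fun c s => map (f c) s) (f0 := fun _ => [::])
  (f1 := fun c a s r => f c a :: r)) => //; first exact: comp_const.
apply: comp_cons; last exact: comp_snd comp_id.
apply: (comp_comp (g := fun p => f p.1 p.2)
  (f := fun p : C * A * seq A * seq B => (p.1.1.1, p.1.1.2))) => //.
by repeat comp_step.
Qed.

Lemma comp_cat C (eC : enc_type C) A (eA : enc_type A) (s t : C -> seq A) :
  computable s -> computable t -> computable (fun c => s c ++ t c).
Proof.
move=> cs ct; apply: (comp_seqrec_at (F := fun c s => s ++ t c) (f0 := t)
  (f1 := fun c a s r => a :: r)) => //.
by repeat comp_step.
Qed.

Lemma comp_flatten C (eC : enc_type C) A (eA : enc_type A) (s : C -> seq (seq A)) :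
  computable s -> computable (fun c => flatten (s c)).
Proof.
apply: (comp_seqrec_at (F := fun c s => flatten s) (f0 := fun _ => [::])
  (f1 := fun c a s r => a ++ r)) => //; first exact: comp_const.
by apply: comp_cat; repeat comp_step.
Qed.

Lemma comp_has C (eC : enc_type C) A (eA : enc_type A) (f : C -> A -> bool) s :
  computable (fun p : C * A => f p.1 p.2) ->
  computable s -> computable (fun c => has (f c) (s c)).
Proof.
move=> cf; apply: (comp_seqrec_at (F := fun c s => has (f c) s) (f0 := fun _ => false)
  (f1 := fun c a s r => f c a || r)) => //; first exact: comp_const.
apply: comp_orb; last exact: comp_snd comp_id.
apply: (comp_comp (g := fun p => f p.1 p.2)
  (f := fun p : C * A * seq A * bool => (p.1.1.1, p.1.1.2))) => //.
by repeat comp_step.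
Qed.

Lemma comp_all C (eC : enc_type C) A (eA : enc_type A) (f : C -> A -> bool) s :
  computable (fun p : C * A => f p.1 p.2) ->
  computable s -> computable (fun c => all (f c) (s c)).
Proof.
move=> cf; apply: (comp_seqrec_at (F := fun c s => all (f c) s) (f0 := fun _ => true)
  (f1 := fun c a s r => f c a && r)) => //; first exact: comp_const.
apply: comp_andb; last exact: comp_snd comp_id.
apply: (comp_comp (g := fun p => f p.1 p.2)
  (f := fun p : C * A * seq A * bool => (p.1.1.1, p.1.1.2))) => //.
by repeat comp_step.
Qed.

Lemma comp_size C (eC : enc_type C) A (eA : enc_type A) (s : C -> seq A) :
  computable s -> computable (fun c => size (s c)).
Proof.
apply: (comp_seqrec_at (F := fun c s => size s) (f0 := fun _ => 0)
  (f1 := fun c a s r => r.+1)) => //; by repeat comp_step.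
Qed.

Lemma comp_addn C (eC : enc_type C) (m n : C -> nat) :
  computable m -> computable n -> computable (fun c => m c + n c).
Proof.
move=> cm cn; apply: (comp_natrec_at (F := fun c m => m + n c) (f0 := n)
  (f1 := fun c m r => r.+1)) => //; by repeat comp_step.
Qed.

Lemma comp_muln C (eC : enc_type C) (m n : C -> nat) :
  computable m -> computable n -> computable (fun c => m c * n c).
Proof.
move=> cm cn; apply: (comp_natrec_at (F := fun c m => m * n c) (f0 := fun _ => 0)
  (f1 := fun c m r => n c + r)) => //; first exact: comp_const.
apply: comp_addn; last by repeat comp_step.
by apply: (comp_comp (g := n)) => //; repeat comp_step.
Qed.

Lemma comp_subn C (eC : enc_type C) (m n : C -> nat) :
  computable m -> computable n -> computable (fun c => m c - n c).
Proof.
move=> cm cn; apply: (comp_natrec_at (F := fun c n => m c - n) (f0 := m)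
  (f1 := fun c m r => r.-1)) => // [|c|c k]; [|by rewrite subn0|by rewrite subnS].
by apply: comp_pred; repeat comp_step.
Qed.

Lemma comp_expn C (eC : enc_type C) (m n : C -> nat) :
  computable m -> computable n -> computable (fun c => m c ^ n c).
Proof.
move=> cm cn; apply: (comp_natrec_at (F := fun c n => m c ^ n) (f0 := fun _ => 1)
  (f1 := fun c n r => m c * r)) => // [||c k]; [exact: comp_const| |by rewrite expnS].
apply: comp_muln; last by repeat comp_step.
by apply: (comp_comp (g := m)) => //; repeat comp_step.
Qed.

Lemma comp_fact C (eC : enc_type C) (n : C -> nat) :
  computable n -> computable (fun c => (n c)`!).
Proof.
move=> cn; apply: (comp_natrec_at (F := fun c n => n`!) (f0 := fun _ => 1)
  (f1 := fun c n r => n.+1 * r)) => //; first exact: comp_const.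
by apply: comp_muln; repeat comp_step.
Qed.

Lemma comp_eqn0 C (eC : enc_type C) (n : C -> nat) :
  computable n -> computable (fun c => n c == 0).
Proof.
move=> cn; apply: (comp_natrec_at (F := fun c n => n == 0) (f0 := fun _ => true)
  (f1 := fun c n r => false)) => //; by repeat comp_step.
Qed.

Lemma comp_leq C (eC : enc_type C) (m n : C -> nat) :
  computable m -> computable n -> computable (fun c => m c <= n c).
Proof. by move=> cm cn; apply: comp_eqn0; exact: comp_subn. Qed.

Lemma comp_eqn C (eC : enc_type C) (m n : C -> nat) :
  computable m -> computable n -> computable (fun c => m c == n c).
Proof.
move=> cm cn; apply: (comp_ext (f := fun c => (m c <= n c) && (n c <= m c))).
  by move=> c; rewrite eqn_leq.
by apply: comp_andb; exact: comp_leq.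
Qed.

Lemma comp_sumn C (eC : enc_type C) (s : C -> seq nat) :
  computable s -> computable (fun c => sumn (s c)).
Proof.
apply: (comp_seqrec_at (F := fun c s => sumn s) (f0 := fun _ => 0)
  (f1 := fun c a s r => a + r)) => //; first exact: comp_const.
by apply: comp_addn; repeat comp_step.
Qed.

Lemma comp_behead C (eC : enc_type C) A (eA : enc_type A) (s : C -> seq A) :
  computable s -> computable (fun c => behead (s c)).
Proof.
apply: (comp_seqrec_at (F := fun c s => behead s) (f0 := fun _ => [::])
  (f1 := fun c a s r => s)) => //; by repeat comp_step.
Qed.

Lemma comp_head C (eC : enc_type C) A (eA : enc_type A) (x : A) (s : C -> seq A) :
  computable s -> computable (fun c => head x (s c)).
Proof.
apply: (comp_seqrec_at (F := fun c s => head x s) (f0 := fun _ => x)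
  (f1 := fun c a s r => a)) => //; by repeat comp_step.
Qed.

Lemma comp_nth C (eC : enc_type C) A (eA : enc_type A) (x : A) (s : C -> seq A) n :
  computable s -> computable n -> computable (fun c => nth x (s c) (n c)).
Proof.
move=> cs cn.
apply: (comp_ext (f := fun c => head x (iter (n c) behead (s c)))).
  move=> c; congr (enc _); elim: (n c) (s c) => [|k IH] [|a l] //=.
    by rewrite -/(iter k.+1 behead [::]) iterSr /= IH nth_nil.
  by rewrite -/(iter k.+1 behead (a :: l)) iterSr /= IH.
apply: comp_head; apply: (comp_iter (f := fun _ => behead)) => //.
by apply: comp_behead; repeat comp_step.
Qed.

Lemma comp_iota0 C (eC : enc_type C) (n : C -> nat) :
  computable n -> computable (fun c => iota 0 (n c)).
Proof.
move=> cn; apply: (comp_natrec_at (F := fun c n => iota 0 n) (f0 := fun _ => [::])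
  (f1 := fun c n r => r ++ [:: n])) => // [||c k]; first exact: comp_const.
  by apply: comp_cat; repeat comp_step.
by rewrite -addn1 iotaD.
Qed.

(** The recursion schemes descend along a single list; hence lengths are compared, and then
    positions. *)
Lemma comp_eqseq C (eC : enc_type C) (s t : C -> seq nat) :
  computable s -> computable t -> computable (fun c => s c == t c).
Proof.
move=> cs ct; apply: (comp_ext (f := fun c => (size (s c) == size (t c)) &&
    all (fun i => nth 0 (s c) i == nth 0 (t c) i) (iota 0 (size (s c))))).
  move=> c; congr (enc _); apply/andP/eqP => [[/eqP sz /allP eq]|->].
    by apply: (@eq_from_nth _ 0) => // i ilt; apply/eqP/eq; rewrite mem_iota.
  by split=> //; apply/allP => i _.
apply: comp_andb; first by apply: comp_eqn; exact: comp_size.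
apply: (comp_all (f := fun c i => nth 0 (s c) i == nth 0 (t c) i)).
  apply: comp_eqn; apply: comp_nth; try by repeat comp_step.
    by apply: (comp_comp (g := s)) => //; repeat comp_step.
  by apply: (comp_comp (g := t)) => //; repeat comp_step.
by apply: comp_iota0; exact: comp_size.
Qed.

Lemma comp_allpairs C (eC : enc_type C) A B R (eA : enc_type A) (eB : enc_type B)
    (eR : enc_type R) (f : C -> A -> B -> R) s t :
  computable (fun p : C * A * B => f p.1.1 p.1.2 p.2) -> computable s -> computable t ->
  computable (fun c => [seq f c a b | a <- s c, b <- t c]).
Proof.
move=> cf cs ct; apply: comp_flatten.
apply: (comp_map (f := fun c a => [seq f c a b | b <- t c])) => //.
apply: (comp_map (f := fun p b => f p.1 p.2 b)) => //.
by apply: (comp_comp (g := t)) => //; repeat comp_step.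
Qed.

(** * Small exponents with the same linear comparisons *)

Section SmallExponents.
Variable I : finType.
Implicit Types a b e f l : I -> nat.

Definition dot a e := \sum_i a i * e i.

(** [C] bounds the coefficients, [M] the additive constants, and [P] is the modulus. Natural
    coefficients on both sides stand for integer ones. *)
Definition sim C M P e e' : Prop :=
  (forall i, e i = e' i %[mod P]) /\
  forall a b d d', (forall i, a i <= C) -> (forall i, b i <= C) -> d <= M -> d' <= M ->
    (dot a e + d <= dot b e + d') = (dot a e' + d <= dot b e' + d').

Lemma sim_sym C M P e e' : sim C M P e e' -> sim C M P e' e.
Proof.
by case=> m c; split=> [i|a b d d' aC bC dM dM']; [rewrite m|rewrite c].
Qed.

Lemma sim_trans C M P e2 e1 e3 : sim C M P e1 e2 -> sim C M P e2 e3 -> sim C M P e1 e3.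
Proof.
case=> m c [m' c']; split=> [i|a b d d' aC bC dM dM']; first by rewrite m m'.
by rewrite c// c'.
Qed.

Lemma dotD a e f : dot a (fun i => e i + f i) = dot a e + dot a f.
Proof. by rewrite /dot -big_split; apply: eq_bigr => i _; rewrite mulnDr. Qed.

Lemma dotM a k e : dot a (fun i => k * e i) = k * dot a e.
Proof. by rewrite /dot big_distrr; apply: eq_bigr => i _; rewrite mulnCA. Qed.

Lemma eq_dot a e f : e =1 f -> dot a e = dot a f.
Proof. by move=> ef; apply: eq_bigr => i _; rewrite ef. Qed.

Lemma eq_sim C M P e f e' f' : e =1 f -> e' =1 f' -> sim C M P e e' -> sim C M P f f'.
Proof.
move=> ef ef' [m c]; split=> [i|a b d d' aC bC dM dM']; first by rewrite -ef -ef'.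
by rewrite -!(eq_dot _ ef) -!(eq_dot _ ef') c.
Qed.

Lemma dot_bits C a l : (forall i, a i <= C) -> (forall i, l i <= 1) ->
  dot a l <= C * #|I|.
Proof.
move=> aC l1; rewrite mulnC -sum_nat_const; apply: leq_sum => i _.
by rewrite -[X in _ <= X]muln1 leq_mul.
Qed.

(* Comparing [2 x + c] with [2 y + c'] amounts to comparing [x + k] with
   [y + k'] for some [k, k' <= max c c' / 2]; hence the condition on [M]. *)
Lemma sim_double C M P e e' l : C * #|I| < M -> (forall i, l i <= 1) ->
  sim C M P e e' -> sim C M P (fun i => l i + 2 * e i) (fun i => l i + 2 * e' i).
Proof.
move=> CM l1 [m c]; split=> [i|a b d d' aC bC dM dM'].
  by apply/eqP; rewrite eqn_modDl -modnMmr m modnMmr.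
have := dot_bits aC l1; have := dot_bits bC l1.
have cmp k k' : k <= M -> k' <= M -> _ := c a b k k' aC bC.
rewrite !(dotD _ l) !dotM; move: (dot a l) (dot b l) => al bl blC alC.
case: (leqP (al + d) (bl + d')) => cc.
  by have := cmp 0 ((bl + d' - (al + d)) %/ 2); lia.
by have := cmp ((al + d - (bl + d') + 1) %/ 2) 0; lia.
Qed.

(** Horner's scheme in base 2: [l] is prepended to both vectors, with one use of [sim_double] for
    each binary digit. *)
Lemma sim_shift C M P t e e' l : C * #|I| < M -> (forall i, l i < 2 ^ t) ->
  sim C M P e e' ->
  sim C M P (fun i => l i + 2 ^ t * e i) (fun i => l i + 2 ^ t * e' i).
Proof.
move=> CM; elim: t l => [|t IH] l lt ee'.
  have l0 i : l i = 0 by have := lt i; rewrite expn0; lia.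
  by apply: eq_sim ee' => i; rewrite l0 expn0; lia.
have := sim_double CM (l := fun i => l i %% 2) _
  (IH (fun i => l i %/ 2) _ ee').
move=> H; apply: eq_sim (H _ _) => i /=; rewrite ?expnS.
- by have := divn_eq (l i) 2; lia.
- by have := divn_eq (l i) 2; lia.
- by lia.
- by have := lt i; rewrite expnS; lia.
Qed.

Definition cmp_index C M : finType :=
  ({ffun I -> 'I_C.+1} * {ffun I -> 'I_C.+1} * 'I_M.+1 * 'I_M.+1)%type.

(** A finite invariant that determines the class under [sim], as the pigeonhole argument requires.
    The modulus is [P.+1], hence never zero. *)
Definition sim_state C M P : finType :=
  ({ffun I -> 'I_P.+1} * {ffun cmp_index C M -> bool})%type.

Definition state_of C M P e : sim_state C M P :=
  ([ffun i => inord (e i %% P.+1)],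
   [ffun x : cmp_index C M => let: (a, b, d, d') := x in
      dot (fun i => a i) e + d <= dot (fun i => b i) e + d']).

Lemma state_of_sim C M P e e' :
  state_of C M P e = state_of C M P e' -> sim C M P.+1 e e'.
Proof.
case=> /ffunP m /ffunP c; split=> [i|a b d d' aC bC dM dM'].
  by have := m i; rewrite !ffunE => /(congr1 val); rewrite /= !inordK ?ltn_pmod.
have := c ([ffun i => inord (a i)], [ffun i => inord (b i)], inord d, inord d').
rewrite !ffunE !inordK//.
have dotE g : (forall i, g i <= C) -> forall f,
    dot (fun i => ([ffun i => inord (g i)] : {ffun I -> 'I_C.+1}) i) f = dot g f.
  by move=> gC f; apply: eq_bigr => i _; rewrite ffunE inordK ?ltnS.
by rewrite !dotE.
Qed.

(* If the vectors [e %/ 2 ^ t1] and [e %/ 2 ^ t2] are in the same state, then the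
   binary digits of [e] between the positions [t1] and [t2] can be removed. *)
Lemma small_exponents C M P e : C * #|I| < M ->
  exists2 e', sim C M P.+1 e e' & forall i, e' i < 2 ^ #|sim_state C M P|.
Proof.
move=> CM; set N := #|_|.
have [s] := ubnP (\sum_i e i); elim: s e => // s IH e; rewrite ltnS => es.
have [/forallP small|] := boolP [forall i, e i < 2 ^ N].
  by exists e => // i; exact: small.
case/forallPn => i; rewrite -leqNgt => ei.
(* The positions [0 .. N] are one more than the states. *)
have : ~~ injectiveb (fun t : 'I_N.+1 => state_of C M P (fun j => e j %/ 2 ^ t)).
  apply/injectiveP => inj; have := leq_card _ inj.
  by rewrite card_ord ltnn.
case/injectivePn => t1 [t2]; wlog lt12 : t1 t2 / t1 < t2 => [wlg|_].
  move=> ne; have [lt|gt|eq] := ltngtP t1 t2.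
  - exact: wlg.
  - by move/esym; apply: wlg => //; rewrite eq_sym.
  - by case/eqP: ne; exact: val_inj.
move=> /esym /state_of_sim/(sim_shift CM (l := fun j => e j %% 2 ^ t1)) ee.
have {}ee := ee t1 (fun j => ltn_pmod (e j) (expn_gt0 2 t1)).
have lt12' : 2 ^ t1 < 2 ^ t2 by rewrite ltn_exp2l.
have eE j : e j %% 2 ^ t1 + 2 ^ t1 * (e j %/ 2 ^ t1) = e j.
  by rewrite addnC mulnC -divn_eq.
have le12 j : e j %/ 2 ^ t2 <= e j %/ 2 ^ t1.
  by apply: leq_div2l; rewrite ?expn_gt0 // ltnW.
case: (IH (fun j => e j %% 2 ^ t1 + 2 ^ t1 * (e j %/ 2 ^ t2))).
  (* The sum decreases at [i]: there [2 ^ t1 <= 2 ^ N <= e i], so the quotient by [2 ^ t1] is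
     positive and dividing it further makes it smaller. *)
  apply: leq_trans es; rewrite (bigD1 i)//= [X in _ < X](bigD1 i)//=.
  rewrite -addSn leq_add//.
    rewrite -[X in _ <= X](eE i) ltn_add2l ltn_pmul2l ?expn_gt0//.
    rewrite -[in X in X < _](subnKC (ltnW lt12)) expnD divnMA ltn_Pdiv//.
      by rewrite -[X in X < _](expn0 2) ltn_exp2l ?subn_gt0.
    rewrite divn_gt0 ?expn_gt0//; apply: leq_trans ei.
    by rewrite leq_exp2l// -ltnS (leq_trans _ (ltn_ord t1))// ltnS ltnW// ltnS.
  by apply: leq_sum => j _; rewrite -[X in _ <= X](eE j) leq_add2l leq_mul2l le12 orbT.
move=> e' ee' small; exists e' => //; apply: sim_trans ee'; apply: sim_sym.
by apply: eq_sim ee => j.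
Qed.
End SmallExponents.

(** * Equality of words made of powers *)

Definition bpow (A : Type) (v : seq A) k := flatten (nseq k v).

Lemma size_bpow (A : Type) (v : seq A) k : size (bpow v k) = size v * k.
Proof. by rewrite mulnC; elim: k => //= k IH; rewrite size_cat IH mulSn. Qed.

Lemma nth_bpow (A : Type) (x : A) v k s : s < size v * k ->
  nth x (bpow v k) s = nth x v (s %% size v).
Proof.
elim: k s => [|k IH] s; first by rewrite muln0.
rewrite mulnS => sv; rewrite /bpow /= nth_cat; case: ltnP => [lt|le].
  by rewrite modn_small.
by rewrite IH ?ltn_subLR// -[in RHS](subnK le) modnDr.
Qed.

Section BlockWords.
Variables (A : eqType) (I : finType).
Implicit Types (e : I -> nat) (b : seq A * option I) (bs : seq (seq A * option I)).

(* A block [(v, Some i)] is the power of [v] whose exponent is the unknown of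
   index [i], and [(v, None)] is [v] itself. *)
Definition block_exp e (o : option I) := if o is Some i then e i else 1.

Definition block_word e bs := flatten [seq bpow b.1 (block_exp e b.2) | b <- bs].

(** The length of a block word is an affine form in the exponents, with these coefficients and the
    constant [cst bs]. *)
Definition coef bs i := \sum_(b <- bs) size b.1 * (b.2 == Some i).
Definition cst bs := \sum_(b <- bs) size b.1 * (b.2 == None).

Lemma block_word_cat e bs bs' :
  block_word e (bs ++ bs') = block_word e bs ++ block_word e bs'.
Proof. by rewrite /block_word map_cat flatten_cat. Qed.

Lemma block_word_cons e b bs :
  block_word e (b :: bs) = bpow b.1 (block_exp e b.2) ++ block_word e bs.
Proof. by []. Qed.

Lemma size_block_word e bs : size (block_word e bs) = dot (coef bs) e + cst bs.
Proof.
elim: bs => [|[v o] bs IH].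
  by rewrite /cst big_nil addn0 /dot big1// => i _; rewrite /coef big_nil.
rewrite block_word_cons size_cat size_bpow IH /cst big_cons /=.
have -> : dot (coef ((v, o) :: bs)) e =
    size v * (\sum_i (o == Some i) * e i) + dot (coef bs) e.
  rewrite /dot big_distrr -big_split; apply: eq_bigr => i _ /=.
  by rewrite /coef big_cons mulnDl mulnA.
have -> : block_exp e o = \sum_i (o == Some i) * e i + (o == None).
  case: o => [i|] /=; last by rewrite big1.
  rewrite (bigD1 i)//= eqxx mul1n big1 ?addn0// => j ji.
  by rewrite (inj_eq Some_inj) eq_sym (negbTE ji).
by rewrite mulnDr !addnA; congr (_ + _); rewrite addnAC.
Qed.

Lemma coef_cat bs bs' i : coef (bs ++ bs') i = coef bs i + coef bs' i.
Proof. by rewrite /coef big_cat. Qed.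

Lemma cst_cat bs bs' : cst (bs ++ bs') = cst bs + cst bs'.
Proof. by rewrite /cst big_cat. Qed.

Lemma nth_block_word x e p b p' s : s < size b.1 * block_exp e b.2 ->
  nth x (block_word e (p ++ b :: p')) (size (block_word e p) + s) =
  nth x b.1 (s %% size b.1).
Proof.
move=> sb; rewrite block_word_cat block_word_cons nth_cat ltnNge leq_addr /=.
by rewrite addKn nth_cat size_bpow sb nth_bpow.
Qed.

Lemma block_at e bs q : q < size (block_word e bs) ->
  exists p b p', [/\ bs = p ++ b :: p', size (block_word e p) <= q &
    q < size (block_word e p) + size b.1 * block_exp e b.2].
Proof.
elim: bs q => [|b bs IH] q //.
rewrite block_word_cons size_cat size_bpow => qlt.
case: (ltnP q (size b.1 * block_exp e b.2)) => qb.
  by exists [::], b, bs.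
have [|p [b' [p' [-> le lt]]]] := IH (q - size b.1 * block_exp e b.2).
  by rewrite ltn_subLR.
exists (b :: p), b', p'; rewrite block_word_cons size_cat size_bpow.
by split=> //; [rewrite -leq_subRL|rewrite -addnA -ltn_subLR].
Qed.

Section Transfer.
Variables (C D M P L : nat) (e e' : I -> nat).
Hypotheses (DM : D + L * L <= M) (LP : forall k, 0 < k -> k <= L -> k %| P).
Hypothesis ee' : sim C M P e e'.

(** Two blocks of length at most [L] have a common period of at most [L * L]. So [M] leaves room for
    an offset of that size in comparisons of prefix lengths, and every period divides [P], so that
    [sim] fixes the residues of these lengths. *)
Definition bounded_blocks bs :=
  [/\ forall i, coef bs i <= C, cst bs <= D & all (fun b => size b.1 <= L) bs].

Lemma bounded_blocks_catl bs bs' : bounded_blocks (bs ++ bs') -> bounded_blocks bs.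
Proof.
case=> c d l; split=> [i||].
- by apply: leq_trans (c i); rewrite coef_cat leq_addr.
- by apply: leq_trans d; rewrite cst_cat leq_addr.
- by move: l; rewrite all_cat => /andP[].
Qed.

Lemma size_block_word_mod bs k : 0 < k -> k <= L ->
  size (block_word e bs) = size (block_word e' bs) %[mod k].
Proof.
move=> k0 kL; rewrite !size_block_word; apply/eqP; rewrite eqn_modDr; apply/eqP.
apply: (big_ind2 (fun x y => x = y %[mod k])) => // [x x' y y' xx yy|i _].
  by rewrite -modnDm xx yy modnDm.
have ekE : e i = e' i %[mod k].
  by case: ee' => /(_ i)/(congr1 (fun x => x %% k)); rewrite !modn_dvdm ?LP.
by rewrite -modnMmr ekE modnMmr.
Qed.

Lemma size_block_word_le bs bs' d : bounded_blocks bs -> bounded_blocks bs' ->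
  d <= L * L ->
  (size (block_word e bs) + d <= size (block_word e bs')) =
  (size (block_word e' bs) + d <= size (block_word e' bs')).
Proof.
case=> c1 d1 _ [c2 d2 _] dL; rewrite !size_block_word -!addnA.
by case: ee' => _; apply=> //; lia.
Qed.

(* The mismatch at [q] lies in the overlap of the blocks [b] and [c], which starts
   at the beginning of [b]; it recurs there with period [size b.1 * size c.1]. *)
Lemma mismatch_transfer x l r q p b p1 r1 c r2 :
  bounded_blocks l -> bounded_blocks r ->
  l = p ++ b :: p1 -> r = r1 ++ c :: r2 ->
  size (block_word e' r1) <= size (block_word e' p) -> size (block_word e' p) <= q ->
  q < size (block_word e' p) + size b.1 * block_exp e' b.2 ->
  q < size (block_word e' r1) + size c.1 * block_exp e' c.2 ->
  nth x (block_word e' l) q != nth x (block_word e' r) q ->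
  block_word e l != block_word e r.
Proof.
move=> bl br lE rE rp pq qb qc; apply: contra => /eqP lr.
have blb : bounded_blocks (p ++ [:: b]) by apply: (@bounded_blocks_catl _ p1); rewrite -catA -lE.
have brc : bounded_blocks (r1 ++ [:: c]) by apply: (@bounded_blocks_catl _ r2); rewrite -catA -rE.
have bp := bounded_blocks_catl blb; have br1 := bounded_blocks_catl brc.
have bL : size b.1 <= L by case: blb => _ _; rewrite all_cat /= andbT => /andP[].
have cL : size c.1 <= L by case: brc => _ _; rewrite all_cat /= andbT => /andP[].
have b0 : 0 < size b.1 by case: (size b.1) qb => //; lia.
have c0 : 0 < size c.1 by case: (size c.1) qc => //; lia.
(* The distance from the start of [b] is reduced modulo a common period of both blocks; the same
   offset is then inspected under [e]. *)
set s := (q - size (block_word e' p)) %% (size b.1 * size c.1).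
have sq : s <= q - size (block_word e' p) := leq_mod _ _.
have sL : s.+1 <= L * L.
  by apply: leq_trans (leq_mul bL cL); rewrite ltn_mod muln_gt0 b0.
have snoc g p' b' : size (block_word g (p' ++ [:: b'])) =
    size (block_word g p') + size b'.1 * block_exp g b'.2.
  by rewrite block_word_cat size_cat block_word_cons size_cat size_bpow addn0.
have rpe : size (block_word e r1) <= size (block_word e p).
  by have := size_block_word_le br1 bp (leq0n _); rewrite !addn0 => ->.
have sb : s < size b.1 * block_exp e b.2.
  have := size_block_word_le bp blb sL; rewrite !snoc leq_add2l => ->.
  by rewrite leq_add2l; clear -sq pq qb; lia.
have sc : size (block_word e p) + s < size (block_word e r1) + size c.1 * block_exp e c.2.
  by have := size_block_word_le bp brc sL; rewrite !snoc addnS => ->; lia.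
have := congr1 (fun w => nth x w (size (block_word e p) + s)) lr.
rewrite {1}lE nth_block_word// rE.
rewrite -[size (block_word e p)](subnKC rpe) -addnA nth_block_word; last by lia.
have -> : s %% size b.1 = (q - size (block_word e' p)) %% size b.1.
  by rewrite modn_dvdm ?dvdn_mulr.
(* The distance between the starts of the two blocks has the same residue modulo [size c.1] under
   [e] and [e'], so the same letter of [c.1] is read. *)
have -> : (size (block_word e p) - size (block_word e r1) + s) %% size c.1 =
    (q - size (block_word e' r1)) %% size c.1.
  have -> : q - size (block_word e' r1) =
      size (block_word e' p) - size (block_word e' r1) + (q - size (block_word e' p)).
    by lia.
  rewrite -modnDm [s %% _]modn_dvdm ?dvdn_mull// modnDm.
  apply/eqP; rewrite eqn_modDr -(eqn_modDl (size (block_word e r1))) subnKC//.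
  rewrite -modnDml (size_block_word_mod r1 c0 cL) modnDml subnKC//.
  by rewrite (size_block_word_mod p c0 cL).
move=> nE; rewrite lE -[in X in X == _](subnKC pq) nth_block_word; last by lia.
by rewrite -[in X in _ == X](subnKC (leq_trans rp pq)) nth_block_word ?nE//; lia.
Qed.

(** Equality of lengths transfers as two comparisons. At a mismatch the two blocks that cover the
    position overlap, and the one that starts later takes the part of [b] in [mismatch_transfer]. *)
Lemma block_word_eq_transfer l r : bounded_blocks l -> bounded_blocks r ->
  block_word e l = block_word e r -> block_word e' l = block_word e' r.
Proof.
move=> bl br lr.
have szE : size (block_word e' l) = size (block_word e' r).
  apply/eqP; rewrite eqn_leq.
  have := size_block_word_le bl br (leq0n _); rewrite !addn0 => <-.
  by have := size_block_word_le br bl (leq0n _); rewrite !addn0 lr => <-; rewrite leqnn.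
case wE: (block_word e' l) => [|x w].
  by move: szE; rewrite wE; case: (block_word e' r).
rewrite -wE; apply: (@eq_from_nth _ x) => // q ql; apply/eqP/negPn/negP => ne.
have [p [b [p1 [lE pq qb]]]] := block_at ql.
have [r1 [c [r2 [rE rq qc]]]] := block_at (eq_ind _ (fun k => q < k) ql _ szE).
have [rp|pr] := leqP (size (block_word e' r1)) (size (block_word e' p)).
  by have := mismatch_transfer bl br lE rE rp pq qb qc ne; rewrite lr eqxx.
move: ne; rewrite eq_sym => ne.
by have := mismatch_transfer br bl rE lE (ltnW pr) rq qc qb ne; rewrite lr eqxx.
Qed.
End Transfer.
End BlockWords.

(** * Finite automata *)

Lemma card_set_type (T : finType) : #|{: {set T}}| = 2 ^ #|T|.
Proof. by rewrite -!cardsT -card_powerset powersetT. Qed.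

Section Automata.
Variable A : eqType.
Implicit Types (r : regex A) (u v : seq A).

(** The start state and the accepting states depend on the expression, so that one transition
    function can serve several expressions. *)
Definition recognizes (T : finType) (step : T -> A -> T) r : Prop :=
  exists (s : T) (acc : pred T), forall u, matches r u <-> acc (foldl step s u).

(** Bounds the automata of [recognizesP]: a word needs its prefixes and a sink; concatenation and
    star pay for a subset construction. *)
Fixpoint regex_card r : nat :=
  match r with
  | RWord u => (size u).+2
  | RCat r1 r2 => regex_card r1 * 2 ^ regex_card r2
  | RAlt r1 r2 => regex_card r1 * regex_card r2
  | RStar r1 => 2 * 2 ^ regex_card r1
  end.

Lemma matches_catP r1 r2 u : matches (RCat r1 r2) u <->
  exists v w, [/\ u = v ++ w, matches r1 v & matches r2 w].
Proof.
split=> [m|[v [w [-> m1 m2]]]]; last exact: MCat.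
by inversion m as [|? ? v w m1 m2| | | |]; subst; exists v, w.
Qed.

Lemma matches_altP r1 r2 u : matches (RAlt r1 r2) u <-> matches r1 u \/ matches r2 u.
Proof.
split=> [m|[]]; [|exact: MAltL|exact: MAltR].
by inversion m; subst; [left|right].
Qed.

(** Empty factors can be skipped, so the first one may be taken nonempty; this permits induction on
    the length. *)
Lemma matches_starP r u : matches (RStar r) u <->
  u = [::] \/ exists v w, [/\ u = v ++ w, v <> [::], matches r v & matches (RStar r) w].
Proof.
split=> [m|[->|[v [w [-> _ m1 m2]]]]]; [|exact: MStar0|exact: MStarS].
remember (RStar r) as s eqn:sE; elim: m sE => // [r' _|r' v w m1 _ m2 IH sE].
  by left.
case: sE => rE; subst r'; case: v m1 => [|a v] m1; first exact: IH.
by right; exists (a :: v), w.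
Qed.

Lemma matches_star_cat r v w :
  matches (RStar r) v -> matches (RStar r) w -> matches (RStar r) (v ++ w).
Proof.
move=> m; remember (RStar r) as s eqn:sE; elim: m sE => // r' u1 u2 m1 _ _ IH sE mw.
have rE : r' = r by case: sE.
by subst r'; rewrite -catA; apply: MStarS => //; exact: IH.
Qed.

(** Runs are analysed by their last letter, so the star is unfolded at its last nonempty factor,
    here [rcons w a]. *)
Lemma matches_star_rcons r u a : matches (RStar r) (rcons u a) <->
  exists v w, [/\ u = v ++ w, matches (RStar r) v & matches r (rcons w a)].
Proof.
split=> [|[v [w [-> m1 m2]]]]; last first.
  rewrite rcons_cat; apply: matches_star_cat => //.
  by rewrite -[rcons w a]cats0; apply: MStarS => //; exact: MStar0.
have [n] := ubnP (size u); elim: n u => // n IH u; rewrite ltnS => un.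
case/matches_starP => [|[v [w [uE v0 m1 m2]]]]; first by case: u un.
case/lastP: w => [|w b] in uE m2.
  by exists [::], u; split=> //; rewrite uE cats0.
move: uE; rewrite -rcons_cat => /rcons_inj[uE ab]; subst b.
have [|v' [w' [wE m3 m4]]] := IH w _ m2.
  by apply: leq_trans un; rewrite uE size_cat; case: v v0 {m1 uE} => //= *; lia.
by exists (v ++ v'), w'; split=> //; [rewrite uE wE catA|exact: MStarS].
Qed.

Lemma recognizes_word u : exists (T : finType) (step : T -> A -> T),
  #|T| <= (size u).+2 /\ recognizes step (RWord u).
Proof.
(* A state [i <= size u] says that the prefix of [u] of length [i] has been read; [ord_max] is the
   sink. *)
pose step (i : 'I_(size u).+2) a : 'I_(size u).+2 :=
  if (i < size u) && (nth a u i == a) then inord i.+1 else ord_max.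
exists 'I_(size u).+2, step; rewrite card_ord; split=> //.
exists ord0, (fun i : 'I_(size u).+2 => i == size u :> nat) => v.
have run w : foldl step ord0 w =
    if prefix w u then inord (size w) else ord_max.
  elim/last_ind: w => [|w a IH].
    by rewrite /= prefix0s; apply: val_inj; rewrite /= inordK.
  have -> : prefix (rcons w a) u = [&& prefix w u, size w < size u & nth a u (size w) == a].
    rewrite !prefixE size_rcons; case: (ltnP (size w) (size u)) => wu.
      by rewrite (take_nth a wu) eqseq_rcons.
    rewrite andbF; apply/negP => /eqP/(congr1 size); rewrite size_rcons size_take.
    by case: ltnP; lia.
  rewrite foldl_rcons IH size_rcons; case: ifP => [pw|_].
    rewrite /step inordK; last by rewrite ltnS leqW// size_prefix.
    by [].
  by rewrite /step /= ltnNge leqnSn.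
rewrite run; have -> : matches (RWord u) v <-> v = u.
  by split=> [m|->]; [inversion m|exact: MWord].
case: ifP => pv.
  rewrite inordK; last by rewrite ltnS leqW// size_prefix.
  split=> [->//|/eqP sz]; move: pv; rewrite prefixE sz take_size.
  by move/eqP.
rewrite /= -{2}[size u]addn0 -addn1 eqn_add2l; split=> // vu.
by move: pv; rewrite vu prefix_refl.
Qed.

Lemma recognizesP r : exists (T : finType) (step : T -> A -> T),
  #|T| <= regex_card r /\ recognizes step r.
Proof.
elim: r => [u|r1 [T1 [f1 [c1 [s1 [acc1 m1]]]]] r2 [T2 [f2 [c2 [s2 [acc2 m2]]]]]|
    r1 [T1 [f1 [c1 [s1 [acc1 m1]]]]] r2 [T2 [f2 [c2 [s2 [acc2 m2]]]]]|
    r [T [f [c [s [acc m]]]]]] /=.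
- exact: recognizes_word.
(* The first component runs on the whole input. The second collects the states reached in [T2] over
   all splits whose first part matches [r1]; [fresh] adds the split at the current position. *)
- pose fresh q := if acc1 q then [set s2] else set0.
  pose step (p : T1 * {set T2}) a :=
    (f1 p.1 a, [set f2 q a | q in p.2] :|: fresh (f1 p.1 a)).
  exists (T1 * {set T2})%type, step; split.
    by rewrite card_prod card_set_type leq_mul// leq_exp2l.
  exists (s1, fresh s1), (fun p : T1 * {set T2} => [exists q in p.2, acc2 q]) => u.
  have run1 w : (foldl step (s1, fresh s1) w).1 = foldl f1 s1 w.
    by elim/last_ind: w => // w a IH; rewrite !foldl_rcons /= IH.
  have run2 q : q \in (foldl step (s1, fresh s1) u).2 <->
      exists v w, [/\ u = v ++ w, matches r1 v & q = foldl f2 s2 w].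
    elim/last_ind: u q => [|u a IH] q.
      rewrite /= /fresh; split.
        by case: ifP; rewrite inE// => a1 /eqP->; exists [::], [::]; split=> //; apply/m1.
      case=> v [w [e mv ->]]; case: v w e mv => [|? ?] [|? ?] //= _ /m1 /= ->.
      by rewrite inE.
    rewrite foldl_rcons /= run1 -foldl_rcons inE; split.
      case/orP.
        case/imsetP => q' /IH[v [w [-> mv ->]]] ->.
        by exists v, (rcons w a); rewrite rcons_cat foldl_rcons.
      rewrite /fresh; case: ifP => [a1|]; rewrite inE// => /eqP->.
      by exists (rcons u a), [::]; rewrite cats0; split=> //; apply/m1.
    case=> v [w []]; case/lastP: w => [|w b].
      rewrite cats0 => <- /m1 a1 /= ->.
      by rewrite /fresh a1 inE eqxx orbT.
    rewrite -rcons_cat => /rcons_inj[uE <-] mv ->; apply/orP; left.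
    by rewrite foldl_rcons imset_f//; apply/IH; exists v, w.
  rewrite matches_catP; split=> [[v [w [uE mv /m2 mw]]]|].
    by apply/exists_inP; exists (foldl f2 s2 w) => //; apply/run2; exists v, w.
  case/exists_inP => q /run2[v [w [uE mv ->]]] mw.
  by exists v, w; split=> //; apply/m2.
- exists (T1 * T2)%type, (fun (p : T1 * T2) a => (f1 p.1 a, f2 p.2 a)); split.
    by rewrite card_prod leq_mul.
  exists (s1, s2), (fun p : T1 * T2 => acc1 p.1 || acc2 p.2) => u.
  have -> : foldl (fun (p : T1 * T2) a => (f1 p.1 a, f2 p.2 a)) (s1, s2) u =
      (foldl f1 s1 u, foldl f2 s2 u).
    by elim/last_ind: u => // u a IH; rewrite !foldl_rcons IH.
  rewrite matches_altP m1 m2 /=; split=> [[->//|->]|/orP//]; exact: orbT.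
(* The flag says whether the input so far matches the star. The set holds the states reached by the
   last, possibly unfinished factor over all splits; [s] joins it when a new factor can start. *)
pose step (p : bool * {set T}) a :=
  let B := [set f q a | q in p.2] in let b := [exists q in B, acc q] in
  (b, if b then s |: B else B).
exists (bool * {set T})%type, step; split.
  by rewrite card_prod card_bool card_set_type leq_mul// leq_exp2l.
exists (true, [set s]), fst => u.
have run : (matches (RStar r) u <-> (foldl step (true, [set s]) u).1) /\
    forall q, q \in (foldl step (true, [set s]) u).2 <->
      exists v w, [/\ u = v ++ w, matches (RStar r) v & q = foldl f s w].
  elim/last_ind: u => [|u a [_ IH]] /=.
    split=> [|q]; first by split=> // _; exact: MStar0.
    rewrite inE; split=> [/eqP->|].
      by exists [::], [::]; split=> //; exact: MStar0.
    by case=> v [w [e _ ->]]; case: v w e => [|? ?] [|? ?].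
  rewrite foldl_rcons /step; set B := [set f q a | q in _].
  have BP q : q \in B <->
      exists v w, [/\ u = v ++ w, matches (RStar r) v & q = foldl f s (rcons w a)].
    split=> [/imsetP[q' /IH[v [w [uE mv ->]]] ->]|[v [w [uE mv ->]]]].
      by exists v, w; rewrite foldl_rcons.
    by rewrite foldl_rcons imset_f//; apply/IH; exists v, w.
  have bP : matches (RStar r) (rcons u a) <-> [exists q in B, acc q].
    rewrite matches_star_rcons; split=> [[v [w [uE mv mw]]]|].
      apply/exists_inP; exists (foldl f s (rcons w a)); last exact/m.
      by apply/BP; exists v, w.
    case/exists_inP => q /BP[v [w [uE mv ->]]] mw; exists v, w; split=> //.
    exact/m.
  split=> // q; split=> /=.
    have fromB : q \in B -> exists v w,
        [/\ rcons u a = v ++ w, matches (RStar r) v & q = foldl f s w].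
      by case/BP => v [w [-> mv ->]]; exists v, (rcons w a); rewrite rcons_cat.
    case: ifP => // b; rewrite inE => /orP[|//]; rewrite inE => /eqP->.
    by exists (rcons u a), [::]; rewrite cats0; split=> //; apply/bP.
  case=> v [w []]; case/lastP: w => [|w b].
    by rewrite cats0 => <- /bP -> ->; rewrite !inE eqxx.
  rewrite -rcons_cat => /rcons_inj[uE <-] mv qE.
  have qB : q \in B by apply/BP; exists v, w.
  by case: ifP => // _; rewrite inE qB orbT.
by case: run.
Qed.

(** The disjoint sum of the automata, so that the numbers of states add up. *)
Lemma recognizes_all (rs : seq (regex A)) : exists (T : finType) (step : T -> A -> T),
  #|T| <= sumn (map regex_card rs) /\ forall r, List.In r rs -> recognizes step r.
Proof.
elim: rs => [|r rs [T2 [f2 [c2 rec2]]]] /=.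
  by exists void, (fun q _ => q); rewrite card_void.
have [T1 [f1 [c1 [s1 [acc1 m1]]]]] := recognizesP r.
pose step (q : T1 + T2) a := match q with inl q => inl (f1 q a) | inr q => inr (f2 q a) end.
exists (T1 + T2)%type, step; split; first by rewrite card_sum leq_add.
have runl q u : foldl step (inl q) u = inl (foldl f1 q u) by elim: u q => /=.
have runr q u : foldl step (inr q) u = inr (foldl f2 q u) by elim: u q => /=.
move=> r' [<-|/rec2[s2 [acc2 m2]]].
  exists (inl s1), (fun q => if q is inl q then acc1 q else false) => u.
  by rewrite runl m1.
exists (inr s2), (fun q => if q is inr q then acc2 q else false) => u.
by rewrite runr m2.
Qed.
End Automata.

(** * Small words with the same transitions *)

(** The orbit of [x] enters a cycle within [n] steps, and the length of the cycle is at most [n], so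
    it divides the factorial. If [k < n], the truncated values already give [k = k']. *)
Lemma iter_mod_fact (T : finType) (f : T -> T) (n k k' : nat) (x : T) :
  #|T| <= n -> k = k' %[mod n`!] -> minn k n = minn k' n -> iter k f x = iter k' f x.
Proof.
move=> Tn; wlog kk' : k k' / k <= k' => [wlg km kn|].
  by have [le|/ltnW le] := leqP k k'; [|symmetry]; apply: wlg.
move=> km kn; have [lt|nk] := ltnP k n; first by congr (iter _ _ _); lia.
have : ~~ injectiveb (fun i : 'I_n.+1 => iter i f x).
  apply/injectiveP => inj; have := leq_card _ inj; rewrite card_ord.
  by move=> nT; have := leq_trans nT Tn; rewrite ltnn.
case/injectivePn => i [j]; wlog ij : i j / i < j => [wlg|_ eqij].
  move=> ne; have [lt|gt|eq] := ltngtP i j.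
  - exact: wlg.
  - by move/esym; apply: wlg => //; rewrite eq_sym.
  - by case/eqP: ne; exact: val_inj.
have period l : i <= l -> iter (l + (j - i)) f x = iter l f x.
  move=> il; rewrite -[l in RHS](subnK il) [in RHS]iterD [in RHS]eqij -iterD.
  by congr (iter _ _ _); lia.
have /dvdnP[m mE] : (j - i) %| n`!.
  by rewrite dvdn_fact// subn_gt0 ij /= (leq_trans (leq_subr _ _))// -ltnS.
have periods l t : i <= l -> iter (l + t * (j - i)) f x = iter l f x.
  move=> il; elim: t => [|t IH]; first by rewrite addn0.
  by rewrite mulSn addnCA addnC period ?IH// (leq_trans il)// leq_addr.
have /dvdnP[t tE] : n`! %| k' - k by rewrite -eqn_mod_dvd//; apply/eqP.
rewrite -(subnKC kk') tE mE mulnA periods// (leq_trans _ nk)//.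
by rewrite -ltnS.
Qed.

Section SmallWords.
Variables (A : Type) (T : finType) (step : T -> A -> T) (n : nat).
Implicit Types u v : seq A.

(** Lengths are recorded only up to the threshold [n], later chosen above all constants of the
    length constraints. *)
Definition same_action u v : Prop :=
  (forall q, foldl step q u = foldl step q v) /\ minn (size u) n = minn (size v) n.

Lemma same_action_cat u u' v v' :
  same_action u u' -> same_action v v' -> same_action (u ++ v) (u' ++ v').
Proof.
case=> a s [a' s']; split=> [q|]; first by rewrite !foldl_cat a a'.
by rewrite !size_cat; lia.
Qed.

(** Two prefixes that act alike enclose a factor that can be cut out. The bound counts the pairs of
    a transformation of [T] and a truncated length. *)
Lemma small_word u : exists2 v, same_action u v & size v < #|T| ^ #|T| * n.+1.
Proof.
have [s] := ubnP (size u); elim: s u => // s IH u; rewrite ltnS => us.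
have [small|big] := ltnP (size u) (#|T| ^ #|T| * n.+1); first by exists u.
pose state (v : seq A) : {ffun T -> T} * 'I_n.+1 :=
  ([ffun q => foldl step q v], inord (minn (size v) n)).
have : ~~ injectiveb (fun i : 'I_(size u).+1 => state (take i u)).
  apply/injectiveP => inj; have := leq_card _ inj.
  by rewrite card_prod card_ffun !card_ord ltnNge big.
case/injectivePn => i [j]; wlog ij : i j / i < j => [wlg|_].
  move=> ne; have [lt|gt|eq] := ltngtP i j.
  - exact: wlg.
  - by move/esym; apply: wlg => //; rewrite eq_sym.
  - by case/eqP: ne; exact: val_inj.
case=> /ffunP act /(congr1 val); rewrite /= !inordK ?ltnS ?geq_minr// => sz.
have aij : same_action (take i u) (take j u).
  by split=> // q; have := act q; rewrite !ffunE.
have [|v [av sv] vsmall] := IH (take i u ++ drop j u).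
  have := ltn_ord i; have := ltn_ord j; rewrite !ltnS => ju iu.
  by rewrite size_cat size_drop size_takel//; clear -us ij ju; lia.
have [a s'] := same_action_cat aij (conj (fun=> erefl) erefl :
  same_action (drop j u) (drop j u)).
rewrite cat_take_drop in a s'; exists v => //.
by split=> [q|]; rewrite -?a -?s'.
Qed.
End SmallWords.

(** * Small models *)

Section BoundedWords.
Variable A : eqType.
Implicit Types (u v : seq A) (vs : seq (seq A)) (e : nat -> nat).

Definition pow_word vs e := flatten [seq bpow (nth [::] vs i) (e i) | i <- iota 0 (size vs)].

Definition bounded vs u : Prop := exists e, u = pow_word vs e.

Definition bounded_regex vs : regex A :=
  foldr (fun v r => RCat (RStar (RWord v)) r) (RWord [::]) vs.

Lemma pow_word_cons v vs e :
  pow_word (v :: vs) e = bpow v (e 0) ++ pow_word vs (fun i => e i.+1).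
Proof. by rewrite /pow_word /= (iotaDl 1 0) -map_comp. Qed.

Lemma eq_pow_word vs e e' :
  (forall i, i < size vs -> e i = e' i) -> pow_word vs e = pow_word vs e'.
Proof.
move=> ee'; rewrite /pow_word; congr flatten; apply/eq_in_map => i.
by rewrite mem_iota => /andP[_ ilt]; rewrite ee'.
Qed.

Lemma matches_star_word v u : matches (RStar (RWord v)) u <-> exists k, u = bpow v k.
Proof.
split=> [m|[k ->]].
  remember (RStar (RWord v)) as r eqn:rE; elim: m rE => // [r' _|r' u1 u2 m1 _ _ IH rE].
    by exists 0.
  have [k ->] := IH rE; case: rE m1 => -> m1; exists k.+1.
  by inversion m1.
elim: k => [|k IH]; first exact: MStar0.
by rewrite /bpow /=; apply: MStarS IH; exact: MWord.
Qed.

Lemma matches_bounded_regex vs u : matches (bounded_regex vs) u <-> bounded vs u.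
Proof.
elim: vs u => [|v vs IH] u.
  split=> [m|[e ->]]; last exact: MWord.
  by exists (fun _ => 0); inversion m.
rewrite /= matches_catP; split=> [[u1 [u2 [-> /matches_star_word[k ->] /IH[e ->]]]]|[e ->]].
  by exists (fun i => if i is j.+1 then e j else k); rewrite pow_word_cons.
rewrite pow_word_cons; exists (bpow v (e 0)), (pow_word vs (fun i => e i.+1)); split=> //.
  by apply/matches_star_word; exists (e 0).
by apply/IH; exists (fun i => e i.+1).
Qed.
End BoundedWords.

(** * Sizes of formulas and the explicit bound on models *)

Section Sizes.
Variable A : Type.

(** The successors make this exceed every variable index, so it also limits the part of an
    assignment that the term can see. *)
Definition sterm_size (t : sterm A) : nat :=
  sumn (map (fun x => match x with SVar X => X.+1 | SConst u => (size u).+1 end) t).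

(** Integer constants are split so that a length constraint becomes a comparison of naturals, with
    the negative parts moved to the right. *)
Definition lconst_neg (k : int) : nat := if k is Negz m then m.+1 else 0.
Definition lconst_pos (k : int) : nat := if k is Posz m then m else 0.

Definition latom_neg (e : latom A) : nat :=
  match e with LConst k => lconst_neg k | _ => 0 end.

Definition latom_pos (sigma : nat -> seq A) (nu : nat -> nat) (e : latom A) : nat :=
  match e with
  | LVar x => nu x
  | LConst k => lconst_pos k
  | LLen t => size (sterm_val sigma t)
  end.

Definition lexp_neg (l : lexp A) := sumn (map (fun p => p.1 * latom_neg p.2) l).
Definition lexp_pos sigma nu (l : lexp A) :=
  sumn (map (fun p => p.1 * latom_pos sigma nu p.2) l).

Lemma lexp_leP sigma nu l c :
  (lexp_val sigma nu l <= c%:Z)%R = (lexp_pos sigma nu l <= c + lexp_neg l).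
Proof.
suff -> : lexp_val sigma nu l = ((lexp_pos sigma nu l)%:Z - (lexp_neg l)%:Z)%R by lia.
rewrite /lexp_val /lexp_pos /lexp_neg; elim: l => [|[a e] l IH]; first by rewrite big_nil.
rewrite big_cons IH /=; case: e => [x|[k|k]|t] /=; lia.
Qed.

Definition latom_size (e : latom A) : nat :=
  match e with LVar x => x.+1 | LConst _ => 0 | LLen t => sterm_size t end.

Definition lexp_size (l : lexp A) := sumn (map (fun p => latom_size p.2) l).

(** The successor in the case of [FLe] puts the threshold above the constant [c + lexp_neg l], so
    that truncated values decide the constraint. *)
Fixpoint formula_size (phi : formula A) : nat :=
  match phi with
  | FEq w => sterm_size w.1 + sterm_size w.2
  | FLe l c => lexp_size l + (c + lexp_neg l).+1
  | FIn t r => sterm_size t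
  | FNot phi1 => formula_size phi1
  | FAnd phi1 phi2 | FOr phi1 phi2 => formula_size phi1 + formula_size phi2
  end.
End Sizes.

Fixpoint formula_regexes (A : eqType) (phi : formula A) : seq (regex A) :=
  match phi with
  | FEq _ | FLe _ _ => [::]
  | FIn _ r => [:: r]
  | FNot phi1 => formula_regexes phi1
  | FAnd phi1 phi2 | FOr phi1 phi2 => formula_regexes phi1 ++ formula_regexes phi2
  end.

Definition words_size (A : Type) (vs : seq (seq A)) := sumn (map (fun v => (size v).+1) vs).

(** One number dominates the variable indices, the constants, the number and lengths of the words
    [vs], and the states of the joint automaton. The successor makes it positive. *)
Definition model_size (A : eqType) (phi : formula A) (vs : seq (seq A)) :=
  (formula_size phi + words_size vs +
   (regex_card (bounded_regex vs) + sumn (map (@regex_card A) (formula_regexes phi)))).+1.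

(** A term of size at most [n] has blocks of total length at most [n * n], since each variable
    contributes the words [vs], of total length at most [n]. *)
Definition max_coef n := n * n.
(** The summands serve, in order, the hypothesis of [small_exponents] with [n.+1 * n.+1] unknowns,
    the constants and the offsets [L * L] in comparisons of block words, and the truncation of
    exponents at [n]. *)
Definition max_gap n := (max_coef n * (n.+1 * n.+1) + max_coef n + n * n + n).+1.
Definition num_states n :=
  n`! ^ (n.+1 * n.+1) *
  2 ^ ((max_coef n).+1 ^ (n.+1 * n.+1) * (max_coef n).+1 ^ (n.+1 * n.+1) *
       (max_gap n).+1 * (max_gap n).+1).
(** The summands limit, in order, the values made of at most [n] powers of words of length at most
    [n], the replacements from [small_word], and the integer variables. The last one also dominates
    the variable indices. *)
Definition model_bound n := n * (n * 2 ^ num_states n) + n ^ n * n.+1 + n.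

Lemma card_sim_state (I : finType) C M P :
  #|sim_state I C M P| =
  P.+1 ^ #|I| * 2 ^ (C.+1 ^ #|I| * C.+1 ^ #|I| * M.+1 * M.+1).
Proof. by rewrite !(card_prod, card_ffun, card_ord, card_bool). Qed.

(** A single exponent is a linear form with one coefficient 1, so its comparisons with constants up
    to [n] are among those that [sim] preserves. *)
Lemma sim_min (I : finType) C M P (e e' : I -> nat) n i :
  0 < C -> n <= M -> sim C M P e e' -> minn (e i) n = minn (e' i) n.
Proof.
move=> C0 nM [_ c].
have dotd f : dot (fun j => (j == i) : nat) f = f i.
  by rewrite /dot (bigD1 i)//= eqxx mul1n big1 ?addn0// => j /negbTE->.
have dot0 f : dot (fun _ : I => 0) f = 0 by rewrite /dot big1.
have cmp k : k <= n -> (e i <= k) = (e' i <= k).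
  move=> kn; have := c (fun j => (j == i) : nat) (fun _ => 0) 0 k.
  rewrite !dotd !dot0 !addn0 !add0n; apply=> //; last exact: leq_trans nM.
  by move=> j; case: eqP.
have := cmp (e i); have := cmp (e' i); have := cmp n; lia.
Qed.

Section SameAction.
Variables (A : eqType) (T : finType) (step : T -> A -> T) (n : nat).
Hypothesis Tn : #|T| <= n.

(** Reading a power iterates the transformation given by [v], so [iter_mod_fact] applies. *)
Lemma same_action_bpow (v : seq A) k k' :
  k = k' %[mod n`!] -> minn k n = minn k' n ->
  same_action step n (bpow v k) (bpow v k').
Proof.
move=> km kn; split=> [q|]; last first.
  rewrite !size_bpow; case: v => [|a v] //=; rewrite !mulSn; have := kn.
  have [lt|ge] := ltnP k n; first by have -> : k' = k by lia.
  by lia.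
have run j : foldl step q (bpow v j) = iter j (fun q => foldl step q v) q.
  by elim: j q => // j IH q; rewrite /bpow /= foldl_cat IH -iterSr.
by rewrite !run; apply: iter_mod_fact Tn km kn.
Qed.

Lemma same_action_recognizes r (u v : seq A) :
  recognizes step r -> same_action step n u v -> matches r u <-> matches r v.
Proof. by case=> s [acc m] [a _]; rewrite !m a. Qed.
End SameAction.

Lemma size_words_le (A : Type) (vs : seq (seq A)) : size vs <= words_size vs.
Proof. by rewrite /words_size; elim: vs => //= v l IH; lia. Qed.

Lemma size_word_le (A : eqType) (vs : seq (seq A)) v :
  v \in vs -> size v <= words_size vs.
Proof.
by rewrite /words_size; elim: vs => //= w l IH; rewrite inE => /orP[/eqP->|/IH]; lia.
Qed.

(** * Transfer of truth between similar assignments *)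

Section Transfer.
Variables (A : eqType) (vs : seq (seq A)) (n : nat).
Hypotheses (vn : words_size vs <= n) (n0 : 0 < n).
Local Notation I := ('I_n.+1 * 'I_n.+1)%type.
Local Notation M := (max_gap n).

(** Each variable has exponents of its own, hence unknowns indexed by a variable and a position in
    [vs]. In all uses below both are at most [n], so [inord] is faithful. *)
Definition var_blocks (X : nat) : seq (seq A * option I) :=
  [seq (nth [::] vs i, Some (inord X, inord i)) | i <- iota 0 (size vs)].

Definition item_blocks (x : sitem A) : seq (seq A * option I) :=
  match x with SVar X => var_blocks X | SConst u => [:: (u, None)] end.

Definition term_blocks (t : sterm A) := flatten (map item_blocks t).

Definition blocks_size (bs : seq (seq A * option I)) := sumn (map (fun b => size b.1) bs).

Lemma coef_le_size bs i : coef bs i <= blocks_size bs.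
Proof.
rewrite /coef /blocks_size sumnE big_map; apply: leq_sum => b _.
by case: eqP; rewrite ?muln1 ?muln0.
Qed.

Lemma cst_le_size bs : cst bs <= blocks_size bs.
Proof.
rewrite /cst /blocks_size sumnE big_map; apply: leq_sum => b _.
by case: eqP; rewrite ?muln1 ?muln0.
Qed.

Lemma blocks_size_var X : blocks_size (var_blocks X) <= n.
Proof.
apply: leq_trans vn; rewrite /blocks_size /var_blocks -map_comp /words_size.
rewrite [in X in _ <= X](_ : vs = [seq nth [::] vs i | i <- iota 0 (size vs)]).
  by rewrite -map_comp !sumnE !big_map; apply: leq_sum => i _ /=.
by rewrite map_nth_iota0 // take_size.
Qed.

Lemma item_size_le t x : List.In x t ->
  (match x with SVar X => X.+1 | SConst u => (size u).+1 end <= @sterm_size A t)%N.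
Proof.
by rewrite /sterm_size; elim: t => //= y t IH [->|/IH]; [exact: leq_addr|lia].
Qed.

Lemma bounded_term_blocks t : sterm_size t <= n ->
  bounded_blocks (max_coef n) (max_coef n) n (term_blocks t).
Proof.
move=> tn; have total : blocks_size (term_blocks t) <= max_coef n.
  have : blocks_size (term_blocks t) <= sterm_size t * n.
    elim: t tn => //= x t IH; rewrite /sterm_size /= => tn.
    rewrite /term_blocks /= /blocks_size map_cat sumn_cat mulnDl leq_add//; last first.
      by apply: IH; apply: leq_trans tn; exact: leq_addl.
    case: x tn => [X|u] tn; last by rewrite /= addn0 mulSn; nia.
    by rewrite mulSn (leq_trans (blocks_size_var X))// leq_addr.
  by move=> le; rewrite (leq_trans le)// leq_mul2r tn orbT.
split=> [i||]; [exact: leq_trans (coef_le_size _ _) total|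
                exact: leq_trans (cst_le_size _) total|].
have {}tn x : List.In x t -> _ := fun xt => leq_trans (item_size_le xt) tn.
rewrite /term_blocks; elim: t tn {total} => //= x t IH tn.
rewrite all_cat IH ?andbT; last by move=> y yt; apply: tn; right.
have := tn x (or_introl erefl); case: x {tn} => [X|u] xn /=; last by lia.
apply/allP => b /mapP[i]; rewrite mem_iota => /andP[_ iv] ->.
by apply: leq_trans vn; apply: size_word_le; apply: mem_nth.
Qed.

Lemma max_gap_coef : max_coef n * #|{: I}| < M.
Proof. by rewrite card_prod !card_ord ltnS /max_gap -!addnA leq_addr. Qed.

Lemma var_blocks_bounded E X :
  block_word E (var_blocks X) = pow_word vs (fun i => E (inord X, inord i)).
Proof. by rewrite /block_word /pow_word /var_blocks -map_comp. Qed.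

Variables (T : finType) (step : T -> A -> T).
Variables (sigma sigma' : nat -> seq A) (nu nu' : nat -> nat) (E E' : I -> nat).
Hypothesis bounded_rec : recognizes step (bounded_regex vs).
Hypothesis acts : forall X, X < n -> same_action step n (sigma X) (sigma' X).
Hypothesis sigma_blocks : forall X, X < n -> bounded vs (sigma X) ->
  sigma X = block_word E (var_blocks X) /\ sigma' X = block_word E' (var_blocks X).
Hypothesis EE' : sim (max_coef n) M n`! E E'.
Hypothesis nu_min : forall x, minn (nu x) n = minn (nu' x) n.

Definition bounded_weq (w : weq A) : Prop :=
  forall s, weq_holds s w -> forall X, X \in weq_vars w -> bounded vs (s X).

Lemma sterm_val_action t : sterm_size t <= n ->
  same_action step n (sterm_val sigma t) (sterm_val sigma' t).
Proof.
elim: t => [|x t IH]; first by [].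
rewrite /sterm_size /= => xn; apply: same_action_cat; last first.
  by apply: IH; apply: leq_trans xn; exact: leq_addl.
by case: x xn => [X|u] xn //=; apply: acts; lia.
Qed.

Lemma sterm_var_lt t X : X \in sterm_vars t -> X < @sterm_size A t.
Proof.
rewrite /sterm_vars /sterm_size; elim: t => //= -[Y|u] t IH /=.
  by rewrite inE => /orP[/eqP->|/IH]; lia.
by move/IH; lia.
Qed.

Lemma sterm_val_blocks t s (F : I -> nat) :
  (forall X, X \in sterm_vars t -> s X = block_word F (var_blocks X)) ->
  sterm_val s t = block_word F (term_blocks t).
Proof.
rewrite /term_blocks; elim: t => //= x t IH sF.
rewrite block_word_cat -IH; last first.
  by move=> X Xt; apply: sF; case: x => [Y|u] //=; rewrite inE Xt orbT.
rewrite /sterm_val /=; congr (_ ++ _); case: x sF => [X|u] sF /=.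
  by apply: sF; rewrite inE eqxx.
by rewrite /block_word /= /bpow /= !cats0.
Qed.

Lemma weq_transfer w : bounded_weq w -> sterm_size w.1 + sterm_size w.2 <= n ->
  weq_holds sigma w <-> weq_holds sigma' w.
Proof.
move=> bw wn.
have w1n : sterm_size w.1 <= n by lia.
have w2n : sterm_size w.2 <= n by lia.
have lt X : X \in weq_vars w -> X < n.
  by rewrite mem_cat => /orP[] /sterm_var_lt; lia.
have bP X : X \in weq_vars w -> bounded vs (sigma X) <-> bounded vs (sigma' X).
  move=> /lt Xn; rewrite -!matches_bounded_regex.
  exact: same_action_recognizes bounded_rec (acts Xn).
(* Boundedness is visible to the automaton, so it holds for [sigma] and [sigma'] together. If [w]
   holds under either, its variables are bounded under both. *)
suff eqs : (forall X, X \in weq_vars w -> bounded vs (sigma X)) ->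
    weq_holds sigma w <-> weq_holds sigma' w.
  by split=> h; apply/eqs => // X Xw; [exact: bw h _ Xw|apply/bP => //; exact: bw h _ Xw].
move=> bs; have sv X : X \in weq_vars w ->
    sigma X = block_word E (var_blocks X) /\ sigma' X = block_word E' (var_blocks X).
  by move=> Xw; apply: sigma_blocks; [exact: lt|exact: bs].
rewrite /weq_holds.
have in1 X : X \in sterm_vars w.1 -> X \in weq_vars w by rewrite mem_cat => ->.
have in2 X : X \in sterm_vars w.2 -> X \in weq_vars w by rewrite mem_cat orbC => ->.
rewrite (sterm_val_blocks (F := E) (fun X h => (sv X (in1 X h)).1)).
rewrite (sterm_val_blocks (F := E) (fun X h => (sv X (in2 X h)).1)).
rewrite (sterm_val_blocks (F := E') (fun X h => (sv X (in1 X h)).2)).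
rewrite (sterm_val_blocks (F := E') (fun X h => (sv X (in2 X h)).2)).
have DM : max_coef n + n * n <= M by rewrite /max_gap; lia.
have LP k : 0 < k -> k <= n -> k %| n`! by move=> k0 kn; rewrite dvdn_fact// k0.
split; apply: (block_word_eq_transfer DM LP); try exact: bounded_term_blocks.
  exact: EE'.
exact: sim_sym.
Qed.

Lemma lexp_transfer l c : lexp_size l + (c + lexp_neg l).+1 <= n ->
  (lexp_val sigma nu l <= c%:Z)%R = (lexp_val sigma' nu' l <= c%:Z)%R.
Proof.
move=> ln; rewrite !lexp_leP.
suff : minn (lexp_pos sigma nu l) n = minn (lexp_pos sigma' nu' l) n by lia.
have : lexp_size l <= n by lia.
rewrite /lexp_size /lexp_pos; elim: l {ln} => //= -[a e] l IH /= ln.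
have ae : minn (latom_pos sigma nu e) n = minn (latom_pos sigma' nu' e) n.
  case: e ln => [x|k|t] //= ln.
  by case: (@sterm_val_action t _) => //; lia.
have {}IH := IH (leq_trans (leq_addl _ _) ln).
(* The truncation of a multiple depends only on the truncated factor, whatever the coefficient
   [a]. *)
suff : minn (a * latom_pos sigma nu e) n = minn (a * latom_pos sigma' nu' e) n by lia.
move: (latom_pos _ _ _) (latom_pos _ _ _) ae => x y xy.
by elim: a => // a IHa; rewrite !mulSn; lia.
Qed.

Lemma holds_transfer phi : formula_size phi <= n -> all_weqs bounded_weq phi ->
  (forall r, List.In r (formula_regexes phi) -> recognizes step r) ->
  holds sigma nu phi <-> holds sigma' nu' phi.
Proof.
elim: phi => [w|l c|t r|phi IH|phi1 IH1 phi2 IH2|phi1 IH1 phi2 IH2] /= pn bw rec.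
- exact: weq_transfer.
- by rewrite lexp_transfer.
- apply: same_action_recognizes (sterm_val_action pn).
  by apply: rec; left.
- by rewrite IH.
- case: bw => bw1 bw2; rewrite IH1 ?IH2//; try lia.
    by move=> r rin; apply: rec; apply: List.in_or_app; right.
  by move=> r rin; apply: rec; apply: List.in_or_app; left.
- case: bw => bw1 bw2; rewrite IH1 ?IH2//; try lia.
    by move=> r rin; apply: rec; apply: List.in_or_app; right.
  by move=> r rin; apply: rec; apply: List.in_or_app; left.
Qed.
End Transfer.

Theorem small_model (A : eqType) (phi : formula A) (vs : seq (seq A)) :
  all_weqs (bounded_weq vs) phi -> satisfiable phi ->
  let K := model_bound (model_size phi vs) in
  exists (sigma : nat -> seq A) (nu : nat -> nat),
    [/\ holds sigma nu phi, forall X, size (sigma X) <= K & forall x, nu x <= K].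
Proof.
set n := model_size phi vs => bw [sigma [nu phiP]] K.
have n0 : 0 < n by [].
have pn : formula_size phi <= n by rewrite /n /model_size; lia.
have vn : words_size vs <= n by rewrite /n /model_size; lia.
have [T [step [Tc rec]]] := recognizes_all (bounded_regex vs :: formula_regexes phi).
have Tn : #|T| <= n by apply: leq_trans Tc _; rewrite /n /model_size /=; lia.
have brec : recognizes step (bounded_regex vs) by apply: rec; left.
have [s0 [acc accP]] := brec.
have bndP u : bounded vs u <-> acc (foldl step s0 u).
  by rewrite -matches_bounded_regex.
(* Exponents are chosen for finitely many variables at once. For a value rejected by the automaton
   the condition is void and the default is zero. *)
have [|f fP] := @fin_all_exists 'I_n.+1 (fun _ => nat -> nat)
    (fun X e => bounded vs (sigma X) -> sigma X = pow_word vs e).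
  move=> X; case ac: (acc (foldl step s0 (sigma X))).
    by have /bndP[e eE] := ac; exists e.
  by exists (fun _ => 0) => /bndP; rewrite ac.
have [|g gP] := @fin_all_exists 'I_n.+1 (fun _ => seq A)
    (fun X v => same_action step n (sigma X) v /\ size v < #|T| ^ #|T| * n.+1).
  by move=> X; have [v v1 v2] := small_word step n (sigma X); exists v.
pose E (i : 'I_n.+1 * 'I_n.+1) := f i.1 i.2.
have [E' EE' small] := small_exponents (n`!).-1 E (max_gap_coef n).
rewrite prednK ?fact_gt0// in EE'.
(* Variables from [n] on do not occur in the formula; the empty word keeps the bound uniform. *)
pose sigma' X := if X < n then
  (if acc (foldl step s0 (sigma X)) then block_word E' (var_blocks vs n X)
   else g (inord X)) else [::].
have sigmaE X : X < n -> bounded vs (sigma X) -> sigma X = block_word E (var_blocks vs n X).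
  move=> Xn bX; rewrite var_blocks_bounded -[X in sigma X](@inordK n) ?ltnS 1?ltnW//.
  rewrite fP ?inordK ?ltnS 1?ltnW//; apply: eq_pow_word => i ilt.
  by rewrite /E /= !inordK//; have := size_words_le vs; clear -Xn ilt vn; lia.
(* Length constraints see integer values only up to the threshold [n]. *)
exists sigma', (fun x => minn (nu x) n); split.
- apply/(holds_transfer vn n0 (step := step) (sigma := sigma) (nu := nu) (E := E) (E' := E')) => //.
  + move=> X Xn; rewrite /sigma' Xn; case: ifP => ac; last first.
      by case: (gP (inord X)); rewrite (inordK (leqW Xn)).
    rewrite {1}sigmaE//; last exact/bndP.
    rewrite /var_blocks; elim: (iota 0 _) => //= i l IH.
    rewrite !block_word_cons; apply: same_action_cat => //=.
    apply: (same_action_bpow step Tn); first by case: EE' => ->.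
    by apply: sim_min EE'; rewrite /max_coef ?muln_gt0 ?n0// /max_gap; lia.
  + move=> X Xn bX; rewrite /sigma' Xn; split; first exact: sigmaE.
    by have /bndP -> := bX.
  + by move=> x; lia.
  + by move=> r rin; apply: rec; right.
- move=> X; rewrite /sigma'; case: ifP => // Xn; case: ifP => ac.
    suff : size (block_word E' (var_blocks vs n X)) <= n * (n * 2 ^ num_states n).
      by rewrite /K /model_bound -addnA => /leq_trans; apply; exact: leq_addr.
    rewrite var_blocks_bounded /pow_word size_flatten /shape -map_comp sumnE big_map.
    apply: (@leq_trans (\sum_(i <- iota 0 (size vs)) n * 2 ^ num_states n)).
      rewrite big_seq [X in _ <= X]big_seq; apply: leq_sum => i; rewrite mem_iota => /andP[_ iv] /=.
      rewrite size_bpow leq_mul//.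
        by apply: leq_trans vn; apply: size_word_le; exact: mem_nth.
      apply: ltnW; apply: leq_trans (small _) _.
      rewrite card_sim_state card_prod !card_ord prednK ?fact_gt0//.
    rewrite big_const_seq count_predT size_iota iter_addn_0 mulnC leq_mul2r.
    by rewrite (leq_trans (size_words_le vs) vn) orbT.
  have [_ /ltnW le] := gP (inord X); apply: leq_trans le _.
  rewrite /K /model_bound -addnA addnCA; apply: leq_trans (leq_addr _ _).
  rewrite leq_mul2r /=; case: (posnP #|T|) => [->|T0]; first by rewrite expn_gt0 n0.
  by apply: leq_trans (leq_pexp2l _ Tn) => //; rewrite leq_exp2r.
- by move=> x; rewrite /K /model_bound; lia.
Qed.

(** * Words bounded by a solved form *)

Section BoundedCat.
Variable A : eqType.
Implicit Types (u v x y : seq A) (vs ws : seq (seq A)).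

Lemma bounded_consP v vs u :
  bounded (v :: vs) u <-> exists k u', u = bpow v k ++ u' /\ bounded vs u'.
Proof.
split=> [[e ->]|[k [_ [-> [e ->]]]]].
  by rewrite pow_word_cons; exists (e 0), (pow_word vs (fun i => e i.+1)); split=> //;
    exists (fun i => e i.+1).
by exists (fun i => if i is j.+1 then e j else k); rewrite pow_word_cons.
Qed.

Lemma bounded_nil vs : bounded vs [::].
Proof.
elim: vs => [|v vs IH]; first by exists (fun _ => 0).
by apply/bounded_consP; exists 0, [::].
Qed.

Lemma bounded_cat vs ws u v : bounded vs u -> bounded ws v -> bounded (vs ++ ws) (u ++ v).
Proof.
elim: vs u => [|x vs IH] u; first by case=> e ->.
case/bounded_consP => k [u' [-> bu]] bv; apply/bounded_consP.
by exists k, (u' ++ v); rewrite catA; split=> //; exact: IH.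
Qed.

Lemma bounded_catl vs ws u : bounded vs u -> bounded (vs ++ ws) u.
Proof. by move=> bu; rewrite -[u]cats0; apply: bounded_cat (bounded_nil _). Qed.

Lemma bounded_catr vs ws u : bounded ws u -> bounded (vs ++ ws) u.
Proof. by move=> bu; rewrite -[u]cat0s; apply: bounded_cat bu; exact: bounded_nil. Qed.

(** Additional words take exponent zero. This merges the words of several equations into one
    list. *)
Lemma bounded_flatten (T : Type) (f : T -> seq (seq A)) (s : seq T) z u :
  List.In z s -> bounded (f z) u -> bounded (flatten (map f s)) u.
Proof.
elim: s => //= y s IH [->|zs] bu; first exact: bounded_catl.
by apply: bounded_catr; exact: IH.
Qed.

(* A power of [v] with [size v <= p] has no factor [a^p b], so at most one copy
   of it ends inside or at the boundary of each block. *)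
Lemma unbounded_factor a b p ws x y : a != b -> all (fun v => size v <= p) ws ->
  ~ bounded ws (x ++ bpow (nseq p a ++ [:: b]) (size ws).+1 ++ y).
Proof.
move=> ab; set z := nseq p a ++ _; have zE : size z = p.+1.
  by rewrite size_cat size_nseq addn1.
elim: ws x => [|v ws IH] x.
  move=> _ [e] /(congr1 size).
  by rewrite size_cat (size_cat (bpow _ _)) size_bpow zE /pow_word /=; lia.
case/andP=> vp wsp /bounded_consP[k [u' [uE bu']]].
have powS n : bpow z n.+1 = z ++ bpow z n by [].
(* If the power of [v] ends before the end of [x ++ z], the rest of this prefix becomes the new [x],
   and one copy of [z] is spent. *)
have [short|long] := ltnP (size v * k) (size x + p.+1).
  apply: (IH (drop (size v * k) (x ++ z))) => //.
  rewrite powS -catA catA in uE.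
  have /(congr1 (drop (size v * k))) := uE; rewrite drop_cat size_cat zE short => ->.
  by rewrite drop_cat size_bpow ltnn subnn drop0.
have v0 : 0 < size v by move: long; case: (size v); lia.
have nthv i : i < size x + p.+1 -> nth a (x ++ z) i = nth a v (i %% size v).
  move=> ilt; have /(congr1 (fun s => nth a s i)) := uE.
  rewrite powS -catA catA nth_cat size_cat zE ilt => ->.
  have ik : i < size v * k by lia.
  by rewrite nth_cat size_bpow ik nth_bpow.
(* The power of [v] now covers [x ++ z]. The final [b] and the letter [size v] places before it, an
   [a] of the same copy because [size v <= p], would have to agree. *)
have bE : nth a (x ++ z) (size x + p) = b.
  by rewrite nth_cat ltnNge leq_addr /= addKn nth_cat size_nseq ltnn subnn.
have aE : nth a (x ++ z) (size x + p - size v) = a.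
  rewrite nth_cat; case: ltnP => [lt|ge]; first by lia.
  rewrite nth_cat size_nseq; case: ltnP => [lt|]; last by lia.
  by rewrite nth_nseq lt.
case/eqP: ab; rewrite -aE -bE !nthv; [|lia|lia].
by rewrite -[in RHS](subnK (leq_trans vp (leq_addl (size x) p))) modnDr.
Qed.
End BoundedCat.

Section SolvedFormWords.
Variable Sigma : finType.
Implicit Types (S : eqsystem Sigma) (w : weq Sigma) (t : rhs Sigma).

Definition part_words (p : part Sigma) : seq (seq Sigma) :=
  match p with PConst u | PPow u _ _ => [:: u] | PUnfixed _ => [::] end.

Definition rhs_words t := flatten (map part_words t).

Definition eqsystem_words S := flatten (map (fun e => rhs_words e.2) S).

Definition letter_words : seq (seq Sigma) := [seq [:: a] | a <- enum Sigma].

Lemma bounded_rhs iota ups t :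
  ~~ has (@is_unfixed Sigma) t -> bounded (rhs_words t) (rhs_val iota ups t).
Proof.
rewrite /rhs_words /rhs_val; elim: t => [|p t IH] /=; first by move=> _; exact: bounded_nil.
rewrite negb_or => /andP[pu /IH]; apply: bounded_cat.
case: p pu => [u|u c i|//] _; apply/bounded_consP.
  by exists 1, [::]; rewrite /bpow /= !cats0; split=> //; exact: bounded_nil.
by exists (c * iota i), [::]; rewrite cats0; split=> //; exact: bounded_nil.
Qed.

Lemma mem_unzip1P S X : X \in unzip1 S -> exists t, List.In (X, t) S.
Proof.
elim: S => //= -[Y t] S IH; rewrite inE => /orP[/eqP->|/IH[t' tS]].
  by exists t; left.
by exists t'; right.
Qed.

Lemma mem_unzip1 S X t : List.In (X, t) S -> X \in unzip1 S.
Proof.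
elim: S => //= -[Y s] S IH [[-> _]|/IH XS]; first by rewrite inE eqxx.
by rewrite inE XS orbT.
Qed.

(** The left-hand sides are distinct, so the prescribed values cannot conflict. *)
Lemma eqsystem_solution S (F : rhs Sigma -> seq Sigma) : uniq (unzip1 S) ->
  exists sigma : nat -> seq Sigma, forall X t, List.In (X, t) S -> sigma X = F t.
Proof.
elim: S => [|[Y s] S IH] /=; first by exists (fun _ => [::]).
case/andP=> YS /IH[sigma sigmaP].
exists (fun X => if X == Y then F s else sigma X) => X t [[<- <-]|XS].
  by rewrite eqxx.
case: eqP => [XY|_]; last exact: sigmaP.
by case/negP: YS; rewrite -XY; exact: mem_unzip1 XS.
Qed.

Lemma rhs_val_unfixed t u : has (@is_unfixed Sigma) t ->
  exists x y, rhs_val (fun _ => 0) (fun _ => u) t = x ++ u ++ y.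
Proof.
rewrite /rhs_val; elim: t => //= p t IH; case/orP => [|/IH[x [y ->]]].
  by case: p => //= k _; exists [::], (flatten [seq part_val (fun=> 0) (fun=> u) i | i <- t]).
by exists (part_val (fun=> 0) (fun=> u) p ++ x), y; rewrite catA.
Qed.

(** [S] is what the algorithm returns and [S0] what the hypothesis provides; they are tied through
    the variables and the solutions of [w]. One long word is given to all unfixed parts of [S], and
    the resulting solution must also be described by [S0]. *)
Lemma no_unfixed_solved_form w S S0 : 1 < #|Sigma| ->
  solved_form w S0 -> no_unfixed S0 -> solved_form w S -> no_unfixed S.
Proof.
move=> /card_gt1P[a [b [_ _ ab]]] [_ vars0 _ sol0] nu0 [uS varsS _ solS].
apply/negPn; rewrite -has_predC; apply/negP => hasu.
have [X [t [XS tu]]] : exists X t, List.In (X, t) S /\ has (@is_unfixed Sigma) t.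
  elim: (S) hasu => //= -[X t] S' IH /orP[|/IH[Y [s [YS su]]]].
    by rewrite /= negbK => tu; exists X, t; split=> //; left.
  by exists Y, s; split=> //; right.
have [t0 t0S] : exists t0, List.In (X, t0) S0.
  by apply: mem_unzip1P; rewrite vars0 -varsS; exact: mem_unzip1 XS.
have t0u : ~~ has (@is_unfixed Sigma) t0.
  elim: (S0) nu0 t0S => //= e S' IH /andP[eu S'u] [eE|]; last exact: IH.
  by move: eu; rewrite eE.
(* [p] dominates the length of each word of [t0], and the copies outnumber these words, as
   [unbounded_factor] requires. *)
pose p := words_size (rhs_words t0).
pose u := bpow (nseq p a ++ [:: b]) (size (rhs_words t0)).+1.
have [sigma sigmaP] := eqsystem_solution (rhs_val (fun _ => 0) (fun _ => u)) uS.
have /sol0[iota [ups]] : weq_holds sigma w.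
  by apply/solS; exists (fun _ => 0), (fun _ => u).
move/(_ X t0 t0S); rewrite (sigmaP X t XS).
have [x [y ->]] := rhs_val_unfixed u tu => xuy.
apply: (@unbounded_factor _ a b p (rhs_words t0) x y ab).
  by apply/allP => v; exact: size_word_le.
by rewrite -/u xuy; exact: bounded_rhs.
Qed.

(** Over a single letter unfixed parts cannot be excluded, but every word is a power of that
    letter. *)
Lemma bounded_small_alphabet u : #|Sigma| <= 1 -> bounded letter_words u.
Proof.
move=> S1; case: u => [|a u]; first exact: bounded_nil.
have all_a x : x = a by exact: (fintype_le1P S1).
have -> : letter_words = [:: [:: a]].
  rewrite /letter_words; have : size (enum Sigma) <= 1 by rewrite -cardE.
  have : a \in enum Sigma by rewrite mem_enum.
  case: (enum Sigma) => [|x [|? ?]] //; by rewrite (all_a x).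
apply/bounded_consP; exists (size u).+1, [::]; split; last exact: bounded_nil.
rewrite cats0; elim: (a :: u) (size u).+1 (erefl : size (a :: u) = (size u).+1).
  by case.
by move=> x s IH [|k] //= [/IH]; rewrite /bpow /= (all_a x) => ->.
Qed.

Lemma solved_form_bounded w S : has_regular_solved_form w -> solved_form w S ->
  bounded_weq (eqsystem_words S ++ letter_words) w.
Proof.
case=> S0 [sf0 nu0 _] sf s sw X Xw.
have [S1|S2] := leqP #|Sigma| 1.
  by apply: bounded_catr; exact: bounded_small_alphabet.
have nuS := no_unfixed_solved_form S2 sf0 nu0 sf.
apply: bounded_catl; case: sf => _ varsS _ /(_ s)[/(_ sw)[iota [ups H]] _].
have [t tS] : exists t, List.In (X, t) S by apply: mem_unzip1P; rewrite varsS.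
rewrite (H X t tS); apply: (bounded_flatten (z := (X, t)) tS).
apply: bounded_rhs; elim: (S) nuS tS => //= e S' IH /andP[eu S'u] [eE|]; last exact: IH.
by move: eu; rewrite eE.
Qed.
End SolvedFormWords.

(** * Deciding formulas by bounded search *)

Section Search.
Variable Sigma : finType.
Implicit Types (r : regex Sigma) (phi : formula Sigma) (t : sterm Sigma).

(* The words that match [r], with at most [k] iterations of each star. *)
Fixpoint lang r (k : nat) : seq (seq Sigma) :=
  match r with
  | RWord u => [:: u]
  | RCat r1 r2 => [seq u ++ v | u <- lang r1 k, v <- lang r2 k]
  | RAlt r1 r2 => lang r1 k ++ lang r2 k
  | RStar r1 => iter k (fun l => [::] :: [seq u ++ v | u <- lang r1 k, v <- l]) [:: [::]]
  end.

Lemma lang_sound r k u : u \in lang r k -> matches r u.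
Proof.
elim: r u => [v|r1 IH1 r2 IH2|r1 IH1 r2 IH2|r IH] u /=.
- by rewrite inE => /eqP->; exact: MWord.
- by case/allpairsP => -[v w] [/IH1 m1 /IH2 m2 ->]; exact: MCat.
- by rewrite mem_cat => /orP[/IH1|/IH2]; [exact: MAltL|exact: MAltR].
- elim: {1}k u => [|j IHj] u /=; rewrite inE.
    by move/eqP->; exact: MStar0.
  case/orP => [/eqP->|]; first exact: MStar0.
  by case/allpairsP => -[v w] [/IH m1 /IHj m2 ->]; exact: MStarS.
Qed.

(** A word of length at most [k] in a star is a product of at most [k] nonempty factors, so [k]
    iterations suffice. In the proof [j] counts iterations while the parameter of [lang r k] stays
    fixed. *)
Lemma lang_complete r k u : matches r u -> size u <= k -> u \in lang r k.
Proof.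
elim: r u => [v|r1 IH1 r2 IH2|r1 IH1 r2 IH2|r IH] u /=.
- by move=> m _; inversion m; rewrite inE.
- case/matches_catP => v [w [-> m1 m2]]; rewrite size_cat => uk.
  by apply/allpairsP; exists (v, w); rewrite IH1 ?IH2//=; lia.
- by rewrite mem_cat => /matches_altP[m|m] uk; [rewrite IH1|rewrite IH2 ?orbT].
move=> m uk.
suff gen j : size u <= j ->
    u \in iter j (fun l => [::] :: [seq u ++ v | u <- lang r k, v <- l]) [:: [::]].
  exact: gen.
elim: j u m uk => [|j IHj] u m uk uj /=.
  by rewrite inE; case: u uj {m uk}.
rewrite inE; case/matches_starP: m => [->//|[v [w [uE v0 m1 m2]]]].
have v1 : 0 < size v by case: v v0 {uE m1}.
move: uk uj; rewrite uE size_cat => uk uj.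
apply/orP; right; apply/allpairsP; exists (v, w); split=> //=.
  by apply: IH => //; lia.
apply: IHj => //; first exact: leq_trans (leq_addl _ _) uk.
by rewrite -ltnS (leq_trans _ uj)// -[X in X < _]add0n ltn_add2r.
Qed.

Lemma mem_lang r u : u \in lang r (size u) <-> matches r u.
Proof. by split=> [/lang_sound|m]; last exact: lang_complete. Qed.

Fixpoint holdsb (s : seq (seq Sigma)) (m : seq nat) phi : bool :=
  match phi with
  | FEq w => sterm_val (nth [::] s) w.1 == sterm_val (nth [::] s) w.2
  | FLe l c => lexp_pos (nth [::] s) (nth 0 m) l <= c + lexp_neg l
  | FIn t r => has (fun u => u == sterm_val (nth [::] s) t)
                   (lang r (size (sterm_val (nth [::] s) t)))
  | FNot phi1 => ~~ holdsb s m phi1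
  | FAnd phi1 phi2 => holdsb s m phi1 && holdsb s m phi2
  | FOr phi1 phi2 => holdsb s m phi1 || holdsb s m phi2
  end.

Lemma holdsbP s m phi : reflect (holds (nth [::] s) (nth 0 m) phi) (holdsb s m phi).
Proof.
elim: phi => [w|l c|t r|phi IH|phi1 IH1 phi2 IH2|phi1 IH1 phi2 IH2] /=.
- exact: eqP.
- by rewrite lexp_leP; exact: idP.
- by rewrite has_pred1; apply: (iffP idP) => /mem_lang.
- by apply: (iffP negP) => h /IH.
- by apply: (iffP andP) => -[/IH1 h1 /IH2 h2].
- by apply: (iffP orP) => -[/IH1 h|/IH2 h]; by [left|right].
Qed.

Fixpoint tuples (T : Type) (xs : seq T) (k : nat) : seq (seq T) :=
  if k is j.+1 then [seq x :: l | x <- xs, l <- tuples xs j] else [:: [::]].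

Lemma mem_tuples (T : eqType) (xs l : seq T) :
  all (mem xs) l -> l \in tuples xs (size l).
Proof.
elim: l => //= x l IH /andP[xxs /IH ltup].
by apply/allpairsP; exists (x, l).
Qed.

Definition words (K : nat) : seq (seq Sigma) :=
  flatten [seq tuples (enum Sigma) j | j <- iota 0 K.+1].

Lemma mem_words K u : size u <= K -> u \in words K.
Proof.
move=> uK; apply/flatten_mapP; exists (size u); first by rewrite mem_iota.
by apply: mem_tuples; apply/allP => a _ /=; rewrite mem_enum.
Qed.

(** [K] limits at once the number of variables, the length of the words and the integer values. *)
Definition search K phi : bool :=
  has (fun s => has (fun m => holdsb s m phi) (tuples (iota 0 K.+1) K))
      (tuples (words K) K).

Lemma sterm_val_local sigma sigma' t :
  (forall X, X < sterm_size t -> sigma X = sigma' X) ->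
  sterm_val sigma t = sterm_val sigma' t.
Proof.
move=> ss; rewrite /sterm_val; elim: t ss => //= x t IH ss; congr (_ ++ _).
  by case: x ss => //= X; apply; rewrite /sterm_size /= leq_addr.
by apply: IH => X Xt; apply: ss; rewrite (leq_trans Xt)// /sterm_size leq_addl.
Qed.

(** Variable indices lie below the size of the formula, so finite lists can stand for
    assignments. *)
Lemma holds_local sigma sigma' nu nu' phi :
  (forall X, X < formula_size phi -> sigma X = sigma' X) ->
  (forall x, x < formula_size phi -> nu x = nu' x) ->
  holds sigma nu phi <-> holds sigma' nu' phi.
Proof.
have tv t : (forall X, X < sterm_size t -> sigma X = sigma' X) -> _ :=
  @sterm_val_local sigma sigma' t.
elim: phi => [w|l c|t r|phi IH|phi1 IH1 phi2 IH2|phi1 IH1 phi2 IH2] /= ss nn.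
- by rewrite /weq_holds !tv// => X Xw; apply: ss; lia.
- rewrite !lexp_leP; suff -> : lexp_pos sigma nu l = lexp_pos sigma' nu' l by [].
  have {}ss X : X < lexp_size l -> sigma X = sigma' X by move=> Xl; apply: ss; lia.
  have {}nn x : x < lexp_size l -> nu x = nu' x by move=> xl; apply: nn; lia.
  rewrite /lexp_pos /lexp_size in ss nn *; elim: l ss nn => //= -[a e] l IH ss nn.
  congr (_ + _); last by apply: IH => i il; [apply: ss|apply: nn]; lia.
  congr (_ * _); case: e ss nn => [x|k|t] //= ss nn; first by apply: nn; lia.
  by rewrite tv// => X Xt; apply: ss; lia.
- by rewrite tv.
- by rewrite IH.
- by rewrite IH1 ?IH2// => i il; [apply: ss|apply: nn|apply: ss|apply: nn]; lia.
- by rewrite IH1 ?IH2// => i il; [apply: ss|apply: nn|apply: ss|apply: nn]; lia.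
Qed.

Lemma searchP vs phi : all_weqs (bounded_weq vs) phi ->
  search (model_bound (model_size phi vs)) phi <-> satisfiable phi.
Proof.
set K := model_bound _ => bw; split=> [/hasP[s _ /hasP[m _ /holdsbP h]]|].
  by exists (nth [::] s), (nth 0 m).
case/(small_model bw) => sigma [nu [h sK nK]].
have phiK : formula_size phi <= K.
  by apply: leq_trans (leq_addl _ _); rewrite /model_size -!addnA -addnS leq_addr.
apply/hasP; exists (mkseq sigma K).
  rewrite -[X in tuples _ X](size_mkseq sigma K); apply: mem_tuples.
  by apply/allP => _ /mapP[X _ ->] /=; apply: mem_words; exact: sK.
apply/hasP; exists (mkseq nu K).
  rewrite -[X in tuples _ X](size_mkseq nu K); apply: mem_tuples.
  apply/allP => _ /mapP[x _ ->]; suff : nu x \in iota 0 K.+1 by [].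
  by rewrite mem_iota ltnS nK.
apply/holdsbP; apply: (proj1 (holds_local _ _) h) => i il;
  by rewrite nth_mkseq// (leq_trans il).
Qed.
End Search.

(** * The search is computable *)

Section EncodedSyntax.
Variable Sigma : finType.

(** This and the following instances are convertible to the encodings in which both algorithms are
    specified. *)
#[local] Instance enc_type_letter : enc_type Sigma := fun a => enc (enum_rank a : nat).

Lemma ctP_sitem (x : sitem Sigma) : closed_lterm (enc_sitem x) && is_lam (enc_sitem x).
Proof.
case: x => [X|u]; apply: ctP_scott => //=; rewrite andbT.
  exact: (ct_closed (enc X)).
exact: (ct_closed (enc u)).
Qed.
#[local] Instance enc_type_sitem : enc_type (sitem Sigma) := fun x => CTerm (ctP_sitem x).

Lemma ctP_latom (e : latom Sigma) : closed_lterm (enc_latom e) && is_lam (enc_latom e).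
Proof.
case: e => [x|k|t]; apply: ctP_scott => //=; rewrite andbT.
- exact: (ct_closed (enc x)).
- exact: (ct_closed (enc k)).
- exact: (ct_closed (enc (t : seq (sitem Sigma)))).
Qed.
#[local] Instance enc_type_latom : enc_type (latom Sigma) := fun e => CTerm (ctP_latom e).

Lemma ctP_part (p : part Sigma) : closed_lterm (enc_part p) && is_lam (enc_part p).
Proof.
case: p => [u|u c i|k]; apply: ctP_scott => //=; rewrite ?andbT.
- exact: (ct_closed (enc u)).
- by apply/and3P; split; [exact: (ct_closed (enc u))|exact: (ct_closed (enc c))|
                            exact: (ct_closed (enc i))].
- exact: (ct_closed (enc k)).
Qed.
#[local] Instance enc_type_part : enc_type (part Sigma) := fun p => CTerm (ctP_part p).

Lemma ctP_regex (r : regex Sigma) : closed_lterm (enc_regex r) && is_lam (enc_regex r).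
Proof.
elim: r => [u|r1 /closed_and_lam c1 r2 /closed_and_lam c2|
  r1 /closed_and_lam c1 r2 /closed_and_lam c2|r /closed_and_lam c];
  apply: ctP_scott => //=; rewrite ?c ?c1 ?c2 ?andbT//.
exact: (ct_closed (enc u)).
Qed.
#[local] Instance enc_type_regex : enc_type (regex Sigma) := fun r => CTerm (ctP_regex r).

#[local] Instance enc_type_sterm : enc_type (sterm Sigma) :=
  fun t => enc (t : seq (sitem Sigma)).
#[local] Instance enc_type_lexp : enc_type (lexp Sigma) :=
  fun l => enc (l : seq (nat * latom Sigma)).
#[local] Instance enc_type_weq : enc_type (weq Sigma) :=
  fun w => enc (w : sterm Sigma * sterm Sigma).
#[local] Instance enc_type_rhs : enc_type (rhs Sigma) :=
  fun t => enc (t : seq (part Sigma)).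
#[local] Instance enc_type_eqsystem : enc_type (eqsystem Sigma) :=
  fun S => enc (S : seq (nat * rhs Sigma)).

Lemma ctP_formula (phi : formula Sigma) :
  closed_lterm (enc_formula phi) && is_lam (enc_formula phi).
Proof.
elim: phi => [w|l c|t r|phi /closed_and_lam c|
  phi1 /closed_and_lam c1 phi2 /closed_and_lam c2|
  phi1 /closed_and_lam c1 phi2 /closed_and_lam c2];
  apply: ctP_scott => //=; rewrite ?c ?c1 ?c2 ?andbT//.
- exact: (ct_closed (enc w)).
- by apply/andP; split; [exact: (ct_closed (enc l))|exact: (ct_closed (enc c))].
- by apply/andP; split; [exact: (ct_closed (enc t))|exact: (ct_closed (enc r))].
Qed.
#[local] Instance enc_type_formula : enc_type (formula Sigma) :=
  fun phi => CTerm (ctP_formula phi).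

(** * Case distinction and recursion on the syntax *)

Lemma comp_sitem C R (eC : enc_type C) (eR : enc_type R) (F : C -> sitem Sigma -> R) f0 f1 x :
  computable (fun p : C * nat => f0 p.1 p.2) ->
  computable (fun p : C * seq Sigma => f1 p.1 p.2) ->
  (forall c X, F c (SVar X) = f0 c X) -> (forall c u, F c (SConst u) = f1 c u) ->
  computable x -> computable (fun c => F c (x c)).
Proof.
move=> [t0 t0P] [t1 t1P] F0 F1; apply: comp_at.
apply: (comp_crec (bs := [:: branch t0 [:: false]; branch t1 [:: false]])) => // c.
case=> [X|u].
  by rewrite (@crecE _ 2 0 [:: enc X])// F0 -(t0P (c, X)); exact: branch_f.
by rewrite (@crecE _ 2 1 [:: enc u])// F1 -(t1P (c, u)); exact: branch_f.
Qed.

Lemma comp_latom C R (eC : enc_type C) (eR : enc_type R) (F : C -> latom Sigma -> R)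
    f0 f1 f2 x :
  computable (fun p : C * nat => f0 p.1 p.2) ->
  computable (fun p : C * int => f1 p.1 p.2) ->
  computable (fun p : C * sterm Sigma => f2 p.1 p.2) ->
  (forall c x, F c (LVar x) = f0 c x) -> (forall c k, F c (LConst k) = f1 c k) ->
  (forall c t, F c (LLen t) = f2 c t) ->
  computable x -> computable (fun c => F c (x c)).
Proof.
move=> [t0 t0P] [t1 t1P] [t2 t2P] F0 F1 F2; apply: comp_at.
apply: (comp_crec (bs :=
  [:: branch t0 [:: false]; branch t1 [:: false]; branch t2 [:: false]])) => // c.
case=> [y|k|t].
- by rewrite (@crecE _ 3 0 [:: enc y])// F0 -(t0P (c, y)); exact: branch_f.
- by rewrite (@crecE _ 3 1 [:: enc k])// F1 -(t1P (c, k)); exact: branch_f.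
- by rewrite (@crecE _ 3 2 [:: enc t])// F2 -(t2P (c, t)); exact: branch_f.
Qed.

Lemma comp_part C R (eC : enc_type C) (eR : enc_type R) (F : C -> part Sigma -> R)
    f0 f1 f2 x :
  computable (fun p : C * seq Sigma => f0 p.1 p.2) ->
  computable (fun p : C * seq Sigma * nat * nat => f1 p.1.1.1 p.1.1.2 p.1.2 p.2) ->
  computable (fun p : C * nat => f2 p.1 p.2) ->
  (forall c u, F c (PConst u) = f0 c u) ->
  (forall c u k i, F c (PPow u k i) = f1 c u k i) ->
  (forall c k, F c (PUnfixed k) = f2 c k) ->
  computable x -> computable (fun c => F c (x c)).
Proof.
move=> [t0 t0P] [t1 t1P] [t2 t2P] F0 F1 F2; apply: comp_at.
apply: (comp_crec (bs :=
  [:: branch t0 [:: false]; branch t1 [:: false; false; false];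
      branch t2 [:: false]])) => // c.
case=> [u|u k i|k].
- by rewrite (@crecE _ 3 0 [:: enc u])// F0 -(t0P (c, u)); exact: branch_f.
- rewrite (@crecE _ 3 1 [:: enc u; enc k; enc i])// F1 -(t1P (c, u, k, i)).
  exact: branch_fff.
- by rewrite (@crecE _ 3 2 [:: enc k])// F2 -(t2P (c, k)); exact: branch_f.
Qed.

Lemma comp_regex C R (eC : enc_type C) (eR : enc_type R) (F : C -> regex Sigma -> R)
    f0 f1 f2 f3 x :
  computable (fun p : C * seq Sigma => f0 p.1 p.2) ->
  computable (fun p : C * R * R => f1 p.1.1 p.1.2 p.2) ->
  computable (fun p : C * R * R => f2 p.1.1 p.1.2 p.2) ->
  computable (fun p : C * R => f3 p.1 p.2) ->
  (forall c u, F c (RWord u) = f0 c u) ->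
  (forall c r1 r2, F c (RCat r1 r2) = f1 c (F c r1) (F c r2)) ->
  (forall c r1 r2, F c (RAlt r1 r2) = f2 c (F c r1) (F c r2)) ->
  (forall c r, F c (RStar r) = f3 c (F c r)) ->
  computable x -> computable (fun c => F c (x c)).
Proof.
move=> [t0 t0P] c1 c2 c3 F0 F1 F2 F3; apply: comp_at.
have tt f : computable (fun p : C * R * R => f p.1.1 p.1.2 p.2) ->
    computable (fun p : C * regex Sigma * regex Sigma * R * R => f p.1.1.1.1 p.1.2 p.2).
  move=> cf; apply: (comp_comp (g := fun p => f p.1.1 p.1.2 p.2)
    (f := fun p : C * regex Sigma * regex Sigma * R * R => (p.1.1.1.1, p.1.2, p.2))) => //.
  by repeat comp_step.
have [t1 t1P] := tt _ c1; have [t2 t2P] := tt _ c2.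
have [t3 t3P] : computable (fun p : C * regex Sigma * R => f3 p.1.1 p.2).
  apply: (comp_comp (g := fun p => f3 p.1 p.2)
    (f := fun p : C * regex Sigma * R => (p.1.1, p.2))) => //.
  by repeat comp_step.
apply: (comp_crec (bs :=
  [:: branch t0 [:: false]; branch t1 [:: true; true]; branch t2 [:: true; true];
      branch t3 [:: true]])) => // c.
elim=> [u|r1 IH1 r2 IH2|r1 IH1 r2 IH2|r IH].
- by rewrite (@crecE _ 4 0 [:: enc u])// F0 -(t0P (c, u)); exact: branch_f.
- rewrite (@crecE _ 4 1 [:: enc r1; enc r2])// F1 -(t1P (c, r1, r2, F c r1, F c r2)).
  exact: branch_tt.
- rewrite (@crecE _ 4 2 [:: enc r1; enc r2])// F2 -(t2P (c, r1, r2, F c r1, F c r2)).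
  exact: branch_tt.
- rewrite (@crecE _ 4 3 [:: enc r])// F3 -(t3P (c, r, F c r)).
  exact: branch_t.
Qed.

Lemma comp_formula C R (eC : enc_type C) (eR : enc_type R) (F : C -> formula Sigma -> R)
    f0 f1 f2 f3 f4 f5 x :
  computable (fun p : C * weq Sigma => f0 p.1 p.2) ->
  computable (fun p : C * lexp Sigma * nat => f1 p.1.1 p.1.2 p.2) ->
  computable (fun p : C * sterm Sigma * regex Sigma => f2 p.1.1 p.1.2 p.2) ->
  computable (fun p : C * R => f3 p.1 p.2) ->
  computable (fun p : C * R * R => f4 p.1.1 p.1.2 p.2) ->
  computable (fun p : C * R * R => f5 p.1.1 p.1.2 p.2) ->
  (forall c w, F c (FEq w) = f0 c w) ->
  (forall c l k, F c (FLe l k) = f1 c l k) ->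
  (forall c t r, F c (FIn t r) = f2 c t r) ->
  (forall c phi, F c (FNot phi) = f3 c (F c phi)) ->
  (forall c phi psi, F c (FAnd phi psi) = f4 c (F c phi) (F c psi)) ->
  (forall c phi psi, F c (FOr phi psi) = f5 c (F c phi) (F c psi)) ->
  computable x -> computable (fun c => F c (x c)).
Proof.
move=> [t0 t0P] [t1 t1P] [t2 t2P] c3 c4 c5 F0 F1 F2 F3 F4 F5; apply: comp_at.
have tt f : computable (fun p : C * R * R => f p.1.1 p.1.2 p.2) ->
    computable (fun p : C * formula Sigma * formula Sigma * R * R =>
                  f p.1.1.1.1 p.1.2 p.2).
  move=> cf; apply: (comp_comp (g := fun p => f p.1.1 p.1.2 p.2)
    (f := fun p : C * formula Sigma * formula Sigma * R * R =>
            (p.1.1.1.1, p.1.2, p.2))) => //.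
  by repeat comp_step.
have [t4 t4P] := tt _ c4; have [t5 t5P] := tt _ c5.
have [t3 t3P] : computable (fun p : C * formula Sigma * R => f3 p.1.1 p.2).
  apply: (comp_comp (g := fun p => f3 p.1 p.2)
    (f := fun p : C * formula Sigma * R => (p.1.1, p.2))) => //.
  by repeat comp_step.
apply: (comp_crec (bs :=
  [:: branch t0 [:: false]; branch t1 [:: false; false]; branch t2 [:: false; false];
      branch t3 [:: true]; branch t4 [:: true; true]; branch t5 [:: true; true]])) => // c.
elim=> [w|l k|t r|phi IH|phi IH1 psi IH2|phi IH1 psi IH2].
- by rewrite (@crecE _ 6 0 [:: enc w])// F0 -(t0P (c, w)); exact: branch_f.
- by rewrite (@crecE _ 6 1 [:: enc l; enc k])// F1 -(t1P (c, l, k)); exact: branch_ff.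
- by rewrite (@crecE _ 6 2 [:: enc t; enc r])// F2 -(t2P (c, t, r)); exact: branch_ff.
- by rewrite (@crecE _ 6 3 [:: enc phi])// F3 -(t3P (c, phi, F c phi)); exact: branch_t.
- rewrite (@crecE _ 6 4 [:: enc phi; enc psi])// F4 -(t4P (c, phi, psi, F c phi, F c psi)).
  exact: branch_tt.
- rewrite (@crecE _ 6 5 [:: enc phi; enc psi])// F5 -(t5P (c, phi, psi, F c phi, F c psi)).
  exact: branch_tt.
Qed.

(** * Computability of the sizes, the bound and the search *)

Ltac cstep :=
  first
  [ comp_step
  | lazymatch goal with
    | |- computable (fun c => _ + _) => simple apply comp_addn
    | |- computable (fun c => _ * _) => simple apply comp_muln
    | |- computable (fun c => _ ^ _) => simple apply comp_expn
    | |- computable (fun c => _`!) => simple apply comp_fact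
    | |- computable (fun c => leq _ _) => simple apply comp_leq
    | |- computable (fun c => ~~ _) => simple apply comp_negb
    | |- computable (fun c => _ && _) => simple apply comp_andb
    | |- computable (fun c => _ || _) => simple apply comp_orb
    | |- computable (fun c => _ ++ _) => refine (comp_cat _ _)
    | |- computable (fun c => size _) => refine (comp_size _)
    | |- computable (fun c => sumn _) => refine (comp_sumn _)
    | |- computable (fun c => nth _ _ _) => refine (comp_nth _ _ _)
    | |- computable (fun c => iota 0 _) => refine (comp_iota0 _)
    end ].
Ltac csteps := repeat cstep.

Lemma enc_seq_map A B (g : B -> lterm) (f : A -> B) (l : seq A) :
  enc_seq g (map f l) = enc_seq (fun a => g (f a)) l.
Proof. by elim: l => //= a l ->. Qed.

(** A word and the list of the ranks of its letters have the same encoding, so equality of words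
    reduces to equality of lists of naturals. *)
Lemma comp_eqword C (eC : enc_type C) (u v : C -> seq Sigma) :
  computable u -> computable v -> computable (fun c => u c == v c).
Proof.
have rank (w : C -> seq Sigma) : computable w ->
    computable (fun c => [seq (enum_rank a : nat) | a <- w c]).
  case=> t tP; exists t => c.
  rewrite [X in eqv _ X](_ : _ = ct (enc (w c))); first exact: tP.
  exact: (enc_seq_map (fun n : nat => ct (enc n)) (fun a : Sigma => enum_rank a : nat)).
move=> /rank cu /rank cv; apply: comp_ext (comp_eqseq cu cv) => c; congr (enc _).
apply/eqP/eqP => [|->//]; apply: inj_map => a b /ord_inj; exact: enum_rank_inj.
Qed.

Lemma comp_sterm_val C (eC : enc_type C) s t :
  computable s -> computable t ->
  computable (fun c : C => sterm_val (nth [::] (s c)) (t c : sterm Sigma)).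
Proof.
move=> cs ct; apply: comp_flatten.
apply: (comp_map (f := fun c x => sitem_val (nth [::] (s c)) x)) => //.
apply: (comp_sitem (F := fun p x => sitem_val (nth [::] (s p.1)) x)
  (f0 := fun p X => nth [::] (s p.1) X) (f1 := fun p u => u)) => //; csteps.
by apply: (comp_comp (g := s)) => //; csteps.
Qed.

Lemma comp_sterm_size C (eC : enc_type C) t : computable t ->
  computable (fun c : C => sterm_size (t c : sterm Sigma)).
Proof.
move=> ct; apply: comp_sumn; apply: (comp_map (f := fun _ x =>
  match x with SVar X => X.+1 | SConst u => (size u).+1 end)) => //.
by apply: (comp_sitem (F := fun _ x =>
  match x with SVar X => X.+1 | SConst u => (size u).+1 end)
  (f0 := fun p X => X.+1) (f1 := fun p u => (size u).+1)) => //; csteps.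
Qed.

Lemma comp_lexp_neg C (eC : enc_type C) l : computable l ->
  computable (fun c : C => lexp_neg (l c : lexp Sigma)).
Proof.
move=> cl; apply: comp_sumn; apply: (comp_map (f := fun _ p =>
  p.1 * latom_neg p.2)) => //.
apply: comp_muln; first by csteps.
apply: (comp_latom (F := fun _ e => latom_neg e)
  (f0 := fun _ _ => 0) (f1 := fun _ k => lconst_neg k) (f2 := fun _ _ => 0)) => //; csteps.
apply: (comp_at (F := fun _ k => lconst_neg k)); last by csteps.
by apply: (comp_int_case (F := fun _ k => lconst_neg k)
  (f0 := fun _ _ => 0) (f1 := fun _ m => m.+1)) => //; csteps.
Qed.

Lemma comp_lexp_size C (eC : enc_type C) l : computable l ->
  computable (fun c : C => lexp_size (l c : lexp Sigma)).
Proof.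
move=> cl; apply: comp_sumn; apply: (comp_map (f := fun _ p => latom_size p.2)) => //.
apply: (comp_latom (F := fun _ e => latom_size e)
  (f0 := fun _ x => x.+1) (f1 := fun _ k => 0) (f2 := fun _ t => sterm_size t)) => //; csteps.
by apply: comp_sterm_size; csteps.
Qed.

Lemma comp_lexp_pos C (eC : enc_type C) s m l :
  computable s -> computable m -> computable l ->
  computable (fun c : C => lexp_pos (nth [::] (s c)) (nth 0 (m c)) (l c : lexp Sigma)).
Proof.
move=> cs cm cl; apply: comp_sumn; apply: (comp_map (f := fun c p =>
  p.1 * latom_pos (nth [::] (s c)) (nth 0 (m c)) p.2)) => //.
apply: comp_muln; first by csteps.
apply: (comp_latom (F := fun p e => latom_pos (nth [::] (s p.1)) (nth 0 (m p.1)) e)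
  (f0 := fun p x => nth 0 (m p.1) x) (f1 := fun _ k => lconst_pos k)
  (f2 := fun p t => size (sterm_val (nth [::] (s p.1)) t))) => //; csteps.
- by apply: (comp_comp (g := m)) => //; csteps.
- apply: (comp_at (F := fun _ k => lconst_pos k)); last by csteps.
  by apply: (comp_int_case (F := fun _ k => lconst_pos k)
    (f0 := fun _ m => m) (f1 := fun _ _ => 0)) => //; csteps.
- by apply: comp_sterm_val; csteps; apply: (comp_comp (g := s)) => //; csteps.
Qed.

Lemma comp_regex_card C (eC : enc_type C) r : computable r ->
  computable (fun c : C => regex_card (r c : regex Sigma)).
Proof.
by apply: (comp_regex (F := fun _ r => regex_card r) (f0 := fun _ u => (size u).+2)
  (f1 := fun _ m n => m * 2 ^ n) (f2 := fun _ m n => m * n)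
  (f3 := fun _ n => 2 * 2 ^ n)) => //; csteps.
Qed.

(** The expression is never built: its number of states is computed by recursion on [vs]. *)
Lemma comp_bounded_regex_card C (eC : enc_type C) vs : computable vs ->
  computable (fun c : C => regex_card (bounded_regex (vs c : seq (seq Sigma)))).
Proof.
by apply: (comp_seqrec_at (F := fun _ vs => regex_card (bounded_regex vs))
  (f0 := fun _ => 2) (f1 := fun _ v _ k => 2 * 2 ^ (size v).+2 * 2 ^ k)) => //; csteps.
Qed.

Lemma comp_formula_size C (eC : enc_type C) phi : computable phi ->
  computable (fun c : C => formula_size (phi c : formula Sigma)).
Proof.
apply: (comp_formula (F := fun _ phi => formula_size phi)
  (f0 := fun _ w => sterm_size w.1 + sterm_size w.2)
  (f1 := fun _ l c => lexp_size l + (c + lexp_neg l).+1)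
  (f2 := fun _ t _ => sterm_size t) (f3 := fun _ n => n)
  (f4 := fun _ m n => m + n) (f5 := fun _ m n => m + n)) => //; csteps;
  by first [apply: comp_sterm_size | apply: comp_lexp_size | apply: comp_lexp_neg]; csteps.
Qed.

Lemma comp_formula_regexes C (eC : enc_type C) phi : computable phi ->
  computable (fun c : C => sumn (map (@regex_card Sigma)
    (formula_regexes (phi c : formula Sigma)))).
Proof.
apply: (comp_formula (F := fun _ phi => sumn (map (@regex_card Sigma) (formula_regexes phi)))
  (f0 := fun _ w => 0) (f1 := fun _ l c => 0) (f2 := fun _ t r => regex_card r + 0)
  (f3 := fun _ n => n) (f4 := fun _ m n => m + n) (f5 := fun _ m n => m + n));
  try by move=> *; rewrite //= map_cat sumn_cat.
all: csteps.
by apply: comp_regex_card; csteps.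
Qed.

Lemma comp_model_size C (eC : enc_type C) phi vs : computable phi -> computable vs ->
  computable (fun c : C => model_size (phi c : formula Sigma) (vs c)).
Proof.
move=> cp cv; apply: comp_succ; apply: comp_addn; apply: comp_addn.
- exact: comp_formula_size.
- apply: comp_sumn; apply: (comp_map (f := fun _ (v : seq Sigma) => (size v).+1)) => //.
  by csteps.
- exact: comp_bounded_regex_card.
- exact: comp_formula_regexes.
Qed.

Lemma comp_model_bound C (eC : enc_type C) n : computable n ->
  computable (fun c : C => model_bound (n c)).
Proof.
by move=> cn; rewrite /model_bound /num_states /max_gap /max_coef; csteps.
Qed.

Lemma comp_tuples A C (eA : enc_type A) (eC : enc_type C) (xs : C -> seq A) k :
  computable xs -> computable k -> computable (fun c => tuples (xs c) (k c)).
Proof.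
move=> cxs; apply: (comp_natrec_at (F := fun c k => tuples (xs c) k)
  (f0 := fun _ => [:: [::]]) (f1 := fun c _ r => [seq x :: l | x <- xs c, l <- r])) => //.
  by csteps.
apply: (comp_allpairs (f := fun _ x l => x :: l)); csteps.
by apply: (comp_comp (g := xs)) => //; csteps.
Qed.

Lemma comp_words C (eC : enc_type C) K : computable K ->
  computable (fun c : C => words Sigma (K c)).
Proof.
move=> cK; apply: comp_flatten; apply: (comp_map (f := fun _ j => tuples (enum Sigma) j)).
  by apply: comp_tuples; csteps.
by apply: comp_iota0; csteps.
Qed.

Lemma comp_lang C (eC : enc_type C) r k : computable r -> computable k ->
  computable (fun c : C => lang (r c : regex Sigma) (k c)).
Proof.
move=> cr ck.
apply: (comp_regex (F := fun c r => lang r (k c)) (f0 := fun _ u => [:: u])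
  (f1 := fun _ l1 l2 => [seq u ++ v | u <- l1, v <- l2]) (f2 := fun _ l1 l2 => l1 ++ l2)
  (f3 := fun c l1 => iter (k c) (fun l => [::] :: [seq u ++ v | u <- l1, v <- l]) [:: [::]]))
  => //; csteps.
  by apply: (comp_allpairs (f := fun _ u v => u ++ v)); csteps.
apply: (comp_iter (f := fun p l => [::] :: [seq u ++ v | u <- p.2, v <- l])); csteps.
  by apply: (comp_allpairs (f := fun _ u v => u ++ v)); csteps.
by apply: (comp_comp (g := k)) => //; csteps.
Qed.

Lemma comp_holdsb C (eC : enc_type C) s m phi :
  computable s -> computable m -> computable phi ->
  computable (fun c : C => holdsb (s c) (m c) (phi c : formula Sigma)).
Proof.
move=> cs cm.
apply: (comp_formula (F := fun c phi => holdsb (s c) (m c) phi)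
  (f0 := fun c w => sterm_val (nth [::] (s c)) w.1 == sterm_val (nth [::] (s c)) w.2)
  (f1 := fun c l k => lexp_pos (nth [::] (s c)) (nth 0 (m c)) l <= k + lexp_neg l)
  (f2 := fun c t r => has (fun u => u == sterm_val (nth [::] (s c)) t)
                          (lang r (size (sterm_val (nth [::] (s c)) t))))
  (f3 := fun _ b => ~~ b) (f4 := fun _ a b => a && b) (f5 := fun _ a b => a || b)) => //.
- by apply: comp_eqword; apply: comp_sterm_val; csteps;
    apply: (comp_comp (g := s)) => //; csteps.
- csteps; last by apply: comp_lexp_neg; csteps.
  apply: comp_lexp_pos; csteps; first by apply: (comp_comp (g := s)) => //; csteps.
  by apply: (comp_comp (g := m)) => //; csteps.
- apply: (comp_has (f := fun p u => u == sterm_val (nth [::] (s p.1.1)) p.1.2)).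
    apply: comp_eqword; csteps; apply: comp_sterm_val; csteps.
    by apply: (comp_comp (g := s)) => //; csteps.
  apply: comp_lang; csteps; apply: comp_sterm_val; csteps.
  by apply: (comp_comp (g := s)) => //; csteps.
all: by csteps.
Qed.

Lemma comp_search C (eC : enc_type C) K phi : computable K -> computable phi ->
  computable (fun c : C => search (K c) (phi c : formula Sigma)).
Proof.
move=> cK cphi.
apply: (comp_has (f := fun c s => has (fun m => holdsb s m (phi c))
  (tuples (iota 0 (K c).+1) (K c)))); last first.
  by apply: comp_tuples => //; exact: comp_words.
apply: (comp_has (f := fun p m => holdsb p.2 m (phi p.1))).
  apply: comp_holdsb; csteps.
  by apply: (comp_comp (g := phi)) => //; csteps.
have cK1 : computable (fun p : C * seq (seq Sigma) => K p.1).
  by apply: (comp_comp (g := K)) => //; csteps.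
by apply: comp_tuples => //; csteps.
Qed.

Lemma comp_eqsystem_words C (eC : enc_type C) S : computable S ->
  computable (fun c : C => eqsystem_words (S c : eqsystem Sigma)).
Proof.
move=> cS; apply: comp_flatten.
apply: (comp_map (f := fun _ (e : nat * rhs Sigma) => rhs_words e.2)) => //.
apply: comp_flatten; apply: (comp_map (f := fun _ p => part_words p)); last by csteps.
by apply: (comp_part (F := fun _ p => part_words p) (f0 := fun _ u => [:: u])
  (f1 := fun _ u _ _ => [:: u]) (f2 := fun _ _ => [::])) => //; csteps.
Qed.

Fixpoint formula_weqs (phi : formula Sigma) : seq (weq Sigma) :=
  match phi with
  | FEq w => [:: w]
  | FLe _ _ | FIn _ _ => [::]
  | FNot phi1 => formula_weqs phi1
  | FAnd phi1 phi2 | FOr phi1 phi2 => formula_weqs phi1 ++ formula_weqs phi2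
  end.

Lemma all_weqsP P phi :
  all_weqs P phi <-> forall w, List.In w (formula_weqs phi) -> P w.
Proof.
have app l1 l2 : (forall w, List.In w (l1 ++ l2) -> P w) <->
    (forall w, List.In w l1 -> P w) /\ (forall w, List.In w l2 -> P w).
  split=> [h|[h1 h2] w wl]; last by case: (List.in_app_or _ _ _ wl) => [/h1|/h2].
  by split=> w wl; apply: h; apply: List.in_or_app; [left|right].
elim: phi => [w|l c|t r|phi IH|phi1 IH1 phi2 IH2|phi1 IH1 phi2 IH2] //=.
- by split=> [Pw _ [<-|//]|]; last by apply; left.
- by rewrite IH1 IH2 app.
- by rewrite IH1 IH2 app.
Qed.

Lemma comp_formula_weqs C (eC : enc_type C) phi : computable phi ->
  computable (fun c : C => formula_weqs (phi c)).
Proof.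
by apply: (comp_formula (F := fun _ phi => formula_weqs phi) (f0 := fun _ w => [:: w])
  (f1 := fun _ _ _ => [::]) (f2 := fun _ _ _ => [::]) (f3 := fun _ l => l)
  (f4 := fun _ k l => k ++ l) (f5 := fun _ k l => k ++ l)) => //; csteps.
Qed.

(** * The algorithm *)

Section Algorithm.
Variables (A : cterm) (A_solves : obtains_solved_forms Sigma A).

Lemma solved_form_exists (w : {w : weq Sigma | has_regular_solved_form w}) :
  exists S, solved_form (proj1_sig w) S /\ eqv (App A (enc (proj1_sig w))) (enc S).
Proof.
case: w => w /= [S0 [sf _ _]]; have [|S sfS ev] := A_solves (w := w); first by exists S0.
by exists S; split=> //; exact: evals_eqv ev.
Qed.

(** The specification of [A] only asserts that a suitable output exists. Choice names it, and [A]
    itself remains the realizer. *)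
Definition solve w : eqsystem Sigma :=
  proj1_sig (constructive_indefinite_description _ (solved_form_exists w)).

Lemma comp_solve : computable solve.
Proof.
exists A => w; rewrite /solve.
by case: (constructive_indefinite_description _ _) => S [].
Qed.

Lemma solve_solved_form w : solved_form (proj1_sig w) (solve w).
Proof.
by rewrite /solve; case: (constructive_indefinite_description _ _) => S [].
Qed.

Local Notation good_formula :=
  {phi : formula Sigma | all_weqs (@has_regular_solved_form Sigma) phi}.

(** Pairs each member with its proof, so that [solve] can be mapped over the equations of a
    formula. *)
Fixpoint attach (B : Type) (P : B -> Prop) (l : seq B) :
    (forall b, List.In b l -> P b) -> seq {b | P b} :=
  match l with
  | [::] => fun _ => [::]
  | b :: l1 => fun h =>
      exist _ b (h b (or_introl erefl)) :: attach (fun c cl => h c (or_intror cl))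
  end.

Lemma attachK B (P : B -> Prop) l h : map (@proj1_sig _ _) (@attach B P l h) = l.
Proof. by elim: l h => //= b l IH h; rewrite IH. Qed.

Definition good_weqs (phi : good_formula) :=
  attach (proj1 (all_weqsP _ _) (proj2_sig phi)).

(** Encodings ignore the attached proofs, so the term that lists the equations of a plain formula
    also serves here. *)
Lemma comp_good_weqs : computable good_weqs.
Proof.
have [t tP] := comp_formula_weqs (comp_id (A := formula Sigma)).
exists t => phi; rewrite [X in eqv _ X](_ : _ = ct (enc (formula_weqs (proj1_sig phi)))).
  exact: tP.
rewrite -[in RHS](attachK (proj1 (all_weqsP _ _) (proj2_sig phi))).
exact: esym (enc_seq_map (fun w : weq Sigma => ct (enc w)) _ _).
Qed.

Definition bounding_words (phi : good_formula) : seq (seq Sigma) :=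
  flatten [seq eqsystem_words (solve w) ++ letter_words Sigma | w <- good_weqs phi].

Lemma bounding_wordsP phi :
  all_weqs (bounded_weq (bounding_words phi)) (proj1_sig phi).
Proof.
apply/all_weqsP => w; rewrite -(attachK (proj1 (all_weqsP _ _) (proj2_sig phi))).
case/List.in_map_iff => v [<- vin] s sv X Xv.
apply: (bounded_flatten (z := v) vin).
exact: (solved_form_bounded (proj2_sig v) (solve_solved_form v)) sv X Xv.
Qed.

Definition decide (phi : good_formula) : bool :=
  search (model_bound (model_size (proj1_sig phi) (bounding_words phi))) (proj1_sig phi).

Lemma comp_decide : computable decide.
Proof.
have cproj : computable (fun phi : good_formula => proj1_sig phi).
  by have [t tP] := comp_id (A := formula Sigma); exists t => phi; exact: tP.
apply: comp_search => //; apply: comp_model_bound; apply: comp_model_size => //.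
apply: comp_flatten; apply: (comp_map (f := fun _ w =>
  eqsystem_words (solve w) ++ letter_words Sigma)); last exact: comp_good_weqs.
csteps; apply: comp_eqsystem_words.
by apply: (comp_comp comp_solve); csteps.
Qed.
End Algorithm.
End EncodedSyntax.

Theorem theorem4 (Sigma : finType) :
  (exists A : lterm, closed_lterm A /\ obtains_solved_forms Sigma A) ->
  exists B : lterm, closed_lterm B /\
    decides_satisfiability_on
      (all_weqs (@has_regular_solved_form Sigma)) B.
Proof.
case=> A [cA A_solves].
(* A closed [A] need not be an abstraction, as [cterm] demands. Its eta-expansion is one and
   evaluates alike on encodings. *)
have cl : let t := Lam (App A (Var 0)) in closed_lterm t && is_lam t.
  by rewrite /= andbT /closed_lterm /= (closed_below_leq _ cA).
have A'_solves : obtains_solved_forms Sigma (CTerm cl).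
  move=> w /A_solves[S sf ev]; exists S => //.
  have evw : eqv (App (CTerm cl) (enc_type_weq w)) (App A (enc_type_weq w)).
    by rewrite beta sub_app sub_var_eq unlock (lsubst_closed _ cA).
  exact/evw.
have [t tP] := comp_decide A'_solves.
exists t; split; first exact: ct_closed.
move=> phi phiP; exists (decide A'_solves (exist _ phi phiP)).
  exact: eqv_evals (tP (exist _ phi phiP)).
exact: searchP (bounding_wordsP A'_solves (exist _ phi phiP)).
Qed.
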